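(* Let $T>0$, let $\lambda:[0,T]\to\,]0,\infty[$ be of bounded variation on $[0,T]$, and suppose $c_0=\inf\lambda([0,T])>0$. Let $x_0\in\operatorname{dom}\partial\varphi$ and $v_0\in\partial\varphi(x_0)$, $v_0\neq0$. Then there exists a unique strong solution $(x,v):[0,T]\to H\times H$ of the Cauchy problem $$v(t)\in\partial\varphi(x(t)),\qquad 0\le t\le T,$$ $$\lambda(t)\dot x(t)+\dot v(t)+v(t)+\nabla\psi(x(t))=0,\qquad\text{for a.e. }0\le t\le T,$$ $$x(0)=x_0,\qquad v(0)=v_0.$$
   Context: $H$ is a real Hilbert space. The function $\varphi:H\to\mathbb{R}\cup\{+\infty\}$ is convex, lower semicontinuous and proper, with convex subdifferential $\partial\varphi$ and $\operatorname{dom}\partial\varphi=\{x\in H:\partial\varphi(x)\neq\emptyset\}$. The function $\psi:H\to\mathbb{R}$ is convex and differentiable, and $\nabla\psi$ is Lipschitz continuous on the bounded subsets of $H$. The function $\varphi+\psi$ is bounded from below on $H$. Bounded variation of $\lambda$ on $[0,T]$ means $\sup\sum_{i=1}^p|\lambda(\tau_i)-\lambda(\tau_{i-1})|<+\infty$, the supremum being over all $p\in\mathbb{N}$ and all strictly increasing sequences $\tau_0<\tau_1<\cdots<\tau_p$ of points of $[0,T]$; $\lambda$ may have jumps. A strong solution on $[0,T]$ is a pair $(x,v)$ of absolutely continuous functions $x,v:[0,T]\to H$ satisfying the inclusion for all $t\in[0,T]$, the differential equation for almost every $t\in[0,T]$, and the initial conditions. *)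

(* Defs.v *)
From HB Require Import structures.
From mathcomp Require Import all_boot all_order all_algebra.
From mathcomp Require Import sesquilinear.
From mathcomp Require Import all_classical all_reals all_analysis.

Set Implicit Arguments.
Unset Strict Implicit.
Unset Printing Implicit Defensive.

Import Order.TTheory GRing.Theory Num.Theory.
Import numFieldNormedType.Exports.

Local Open Scope classical_set_scope.
Local Open Scope ring_scope.

(* A real Hilbert space is a complete normed module [H] together with a
   positive definite symmetric form [dot : {dot H for idfun}] such that
   [dot x x = `|x| ^+ 2]. *)

(* The codomain is [\bar R]; [proper_function] excludes the value [-oo]. *)
Definition proper_function (R : realType) (H : Type) (phi : H -> \bar R) : Prop :=
  (forall x, phi x != -oo%E) /\ (exists x, phi x != +oo%E).

(* [convex_function] only covers real-valued functions. At [t = 0] and [t = 1]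
   the convention [0 * +oo = 0] makes the inequality trivial. *)
Definition econvex_function (R : realType) (H : lmodType R)
    (phi : H -> \bar R) : Prop :=
  forall (t : R) (x y : H), 0 <= t <= 1 ->
    (phi (t *: x + (1 - t) *: y)%R <= t%:E * phi x + (1 - t)%:E * phi y)%E.

(* For proper [phi] this set is empty as soon as [phi x = +oo]. *)
Definition subdifferential (R : realType) (H : completeNormedModType R)
    (dot : {dot H for idfun}) (phi : H -> \bar R) (x : H) : set H :=
  [set v | forall y, (phi x + (dot v (y - x)%R)%:E <= phi y)%E].

Definition dom_subdifferential (R : realType) (H : completeNormedModType R)
    (dot : {dot H for idfun}) (phi : H -> \bar R) : set H :=
  [set x | subdifferential dot phi x !=set0].

(* The Riesz representative of the differential of [psi] at [x]; the value is
   meaningful when [psi] is differentiable at [x]. *)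
Definition gradient (R : realType) (H : completeNormedModType R)
    (dot : {dot H for idfun}) (psi : H -> R^o) (x : H) : H :=
  xget 0 [set g | forall h, 'd psi x h = dot g h].

Definition absolutely_continuous (R : realType) (H : normedModType R)
    (a b : R) (f : R -> H) : Prop :=
  forall eps : R, 0 < eps -> exists2 delta : R, 0 < delta &
    forall (n : nat) (l r : 'I_n -> R),
      (forall i, [/\ a <= l i, l i <= r i & r i <= b]) ->
      trivIset [set: 'I_n] (fun i => `]l i, r i[%classic) ->
      \sum_(i < n) (r i - l i) < delta ->
      \sum_(i < n) `|f (r i) - f (l i)| < eps.

(* Functions on [0, T] are represented by functions on [R] of which only the
   values on [0, T] matter: a derivative at [t] with [0 < t < T] does not
   depend on the values outside [0, T], and {0, T} is a null set. *)
Definition strong_solution (R : realType) (H : completeNormedModType R)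
    (dot : {dot H for idfun}) (phi : H -> \bar R) (psi : H -> R^o)
    (T : R) (lambda : R -> R) (x0 v0 : H) (x v : R -> H) : Prop :=
  [/\ absolutely_continuous 0 T x,
      absolutely_continuous 0 T v,
      forall t, 0 <= t <= T -> subdifferential dot phi (x t) (v t),
      {ae (@lebesgue_measure R), forall t, 0 <= t <= T ->
        [/\ derivable x t 1, derivable v t 1 &
            lambda t *: derive1 x t + derive1 v t + v t
              + gradient dot psi (x t) = 0]} &
      x 0 = x0 /\ v 0 = v0].

(* Main.v *)
Require Import Defs.
From HB Require Import structures.
From mathcomp Require Import all_boot all_order all_algebra.
From mathcomp Require Import sesquilinear.
From mathcomp Require Import all_classical all_reals all_analysis.
From mathcomp Require Import ring lra.

Import Order.TTheory GRing.Theory Num.Theory.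
Import numFieldNormedType.Exports.

Local Open Scope classical_set_scope.
Local Open Scope ring_scope.
Set Implicit Arguments.
Unset Strict Implicit.
Unset Printing Implicit Defensive.

(** The proof discretises time. With a step [h], solve
    [lambda(kh) (X_(k+1) - X_k) + (V_(k+1) - V_k) + h (V_k + grad psi (X_k)) = 0]
    with [V_k] in [d phi (X_k)]; each step is one evaluation of a resolvent of
    the subdifferential ([resolvent_exists], [scheme_exists]).

    A priori bounds ([scheme_bounded]). Testing the equation with the increment
    of [X] shows that [phi + psi] decreases and controls the squared increments,
    so [X] stays in a ball, where the gradient of [psi] is Lipschitz. Since
    increments of [X] and [V] have a nonnegative pairing, the equation bounds
    each of them separately by a multiple of [h]: all curves are Lipschitz.

    Stability ([scheme_stability], [scheme_consistency]). For two solutions, let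
    [u] and [w] be the differences of their [X] and [V] components. By
    monotonicity [lambda u + w] dominates both, and it satisfies a discrete
    Gronwall inequality in which a change of [lambda] contributes the factor
    [1 + |d lambda| / c0]. The product of these factors is bounded by the
    exponential of the total variation divided by [c0], whatever the jumps are.
    Freezing [lambda] during a step costs [h] times its variation during this
    step, and these costs sum up to [O(h)]. Hence the schemes with steps
    [h0 / 2^n] converge ([scheme_refine], [scheme_limit]); since a strong
    solution satisfies the scheme up to the same kind of error
    ([solution_residual]), it coincides with the limit, which is uniqueness.

    The limit [(x, v)] is Lipschitz and stays in the graph of the
    subdifferential. Passing to the limit in the summed equation gives
    [limit_interval_estimate]; at a continuity point [t] of the variation of
    [lambda], hence almost everywhere, it says that [lambda(t) x + v] is
    differentiable at [t] with the expected derivative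
    ([interval_estimate_derivative]). It remains to know that [x] is
    differentiable almost everywhere. This is the Radon-Nikodym property of
    Hilbert spaces, proved in [lipschitz_curve_ae_derivable] through the energy
    [sup \sum |dx|^2 / dt]: along a subdivision that almost attains the
    supremum, Vitali's lemma and the Pythagorean identity show that the
    difference quotients are close to the slopes of the chords outside a set of
    small measure.

    For an arbitrary strong solution the differential equation holds almost
    everywhere only; [absolutely_continuous_le], the mean value inequality for
    absolutely continuous curves, converts it into bounds on increments. *)

(** * Inner product *)

Section InnerProduct.
Variables (R : realType) (H : completeNormedModType R).
Variable dot : {dot H for idfun}.
Hypothesis dot_norm : forall x : H, dot x x = `|x| ^+ 2.

Lemma dotC x y : dot x y = dot y x.
Proof. by rewrite hermC expr0 mul1r. Qed.

Lemma dotDl x y z : dot (x + y) z = dot x z + dot y z.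
Proof. exact: linearDl. Qed.

Lemma dotDr x y z : dot z (x + y) = dot z x + dot z y.
Proof. exact: linearDr. Qed.

Lemma dotZl a x z : dot (a *: x) z = a * dot x z.
Proof. by rewrite linearZl_LR. Qed.

Lemma dotZr a x z : dot z (a *: x) = a * dot z x.
Proof. by rewrite dotC dotZl dotC. Qed.

Lemma dotNl x z : dot (- x) z = - dot x z.
Proof. exact: linearNl. Qed.

Lemma dotNr x z : dot z (- x) = - dot z x.
Proof. exact: linearNr. Qed.

Lemma dot0l z : dot 0 z = 0.
Proof. by rewrite -(scale0r (0 : H)) dotZl mul0r. Qed.

Definition dotE := (dotDl, dotDr, dotNl, dotNr, dotZl, dotZr).

Lemma dot_ge0 x : 0 <= dot x x.
Proof. by rewrite dot_norm exprn_ge0. Qed.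

Lemma ler_norm_dot x y : dot x x <= dot y y -> `|x| <= `|y|.
Proof. by rewrite !dot_norm ler_pXn2r// nnegrE. Qed.

Lemma dot_cauchy x y : `|dot x y| <= `|x| * `|y|.
Proof.
have [->|y0] := eqVneq y 0.
  by rewrite -[X in dot _ X](scale0r (0 : H)) dotZr mul0r normr0 mulr_ge0.
have y2 : 0 < dot y y by rewrite dot_norm exprn_gt0// normr_gt0.
rewrite -ler_sqr ?nnegrE ?mulr_ge0// exprMn -!dot_norm real_normK ?num_real//.
have := dot_ge0 (dot y y *: x - dot x y *: y).
rewrite !dotE (dotC y x) => h.
rewrite -(ler_pM2l y2) -subr_ge0.
by apply: le_trans h _; rewrite le_eqVlt; apply/orP; left; apply/eqP; ring.
Qed.

Lemma dot_le x y : dot x y <= `|x| * `|y|.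
Proof. exact: le_trans (ler_norm _) (dot_cauchy x y). Qed.

(** Testing against every vector turns an identity between vectors into one
    between scalars, which [ring] and [field] can settle. *)
Lemma dot_ext x y : (forall z, dot x z = dot y z) -> x = y.
Proof.
move=> h; apply/eqP; rewrite -subr_eq0 -normr_eq0 -sqrf_eq0 -dot_norm.
by rewrite !dotE (h x) (h y); apply/eqP; ring.
Qed.

End InnerProduct.

(** * Resolvents and Riesz representation *)

(** The bound passes to the limit, so the limit comes with a rate. *)
Lemma cauchy_rate_lim (R : realType) (V : completeNormedModType R)
    (u : nat -> V) (r : nat -> R) : r @ \oo --> (0 : R) ->
  (forall n m, (n <= m)%N -> `|u m - u n| <= r n) ->
  exists l, forall n, `|l - u n| <= r n.
Proof.
move=> r0 ur.
have cu : cvg (u @ \oo).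
  apply/cauchy_cvgP/cauchyP => e e0.
  have /cvgrPdist_lt/(_ _ e0) [N _ rN] := r0.
  exists (u N); exists N => // m /= Nm.
  rewrite -ball_normE/= distrC; apply: le_lt_trans (ur _ _ Nm) _.
  by have := rN N (leqnn N); rewrite sub0r normrN; apply: le_lt_trans (ler_norm _).
exists (lim (u @ \oo)) => n.
have h : `|u m - u n| @[m --> \oo] --> `|lim (u @ \oo) - u n|.
  by apply: cvg_norm; apply: cvgB => //; exact: cvg_cst.
rewrite -(cvg_lim (@Rhausdorff R) h).
apply: limr_le; first by apply/cvg_ex; exists `|lim (u @ \oo) - u n|.
by exists n => // m /= nm; exact: ur.
Qed.

Section ConvexAnalysis.
Variables (R : realType) (H : completeNormedModType R).
Variable dot : {dot H for idfun}.
Hypothesis dot_norm : forall x : H, dot x x = `|x| ^+ 2.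

Lemma eR_finite_le (a : \bar R) (b : R) :
  a != -oo%E -> (a <= b%:E)%E -> exists2 f, a = f%:E & f <= b.
Proof. by case: a => // f _; rewrite lee_fin => ?; exists f. Qed.

Section Resolvent.
Variable phi : H -> \bar R.
Hypothesis phi_proper : proper_function phi.
Hypothesis phi_convex : econvex_function phi.
Hypothesis phi_lsc : lower_semicontinuous phi.
Variables A C : R.
Hypothesis phi_lb : forall y, ((A - C * `|y|)%:E <= phi y)%E.

(** Surjectivity of [c + d phi] (Minty): the strongly convex function
    [phi + c/2 |.|^2 - <z, .>] is bounded below, its minimising sequences are
    Cauchy, lower semicontinuity makes the limit a minimiser, and the
    optimality condition along segments is the inclusion. *)
Lemma resolvent_exists (c : R) (z : H) : 0 < c ->
  exists x, subdifferential dot phi x (z - c *: x).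
Proof.
move=> c0.
pose q y := c / 2 * dot y y - dot z y.
pose S := [set j | exists y f, phi y = f%:E /\ j = f + q y].
have [phiN [y0 phiy0]] := phi_proper.
have S0 : S !=set0.
  move: phiy0 (phiN y0); case E : (phi y0) => [f| |] // _ _.
  by exists (f + q y0), y0, f.
pose K := C + `|z|.
have Slb : has_lbound S.
  exists (A - K ^+ 2 / (2 * c)) => j [y [f [yf ->]]].
  have := phi_lb y; rewrite yf lee_fin => h1.
  have h2 := dot_le dot_norm z y.
  rewrite /q dot_norm.
  have h3 : 0 <= (c * `|y| - K) ^+ 2 / (2 * c).
    by rewrite divr_ge0 ?sqr_ge0// mulr_ge0// ltW.
  have h4 : (c * `|y| - K) ^+ 2 / (2 * c) =
      c / 2 * `|y| ^+ 2 - K * `|y| + K ^+ 2 / (2 * c).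
    by field; rewrite gt_eqF.
  rewrite h4 {1}/K in h3; lra.
have infS : has_inf S by [].
pose m := inf S.
have mS j : S j -> m <= j by move=> Sj; exact: ge_inf.
have [y ym] : {y : nat -> H & forall n, exists f, phi (y n) = f%:E /\
    f + q (y n) < m + n.+1%:R^-1}.
  suff h : forall n, exists y, exists f,
      phi y = f%:E /\ f + q y < m + n.+1%:R^-1.
    by exists (fun n => projT1 (cid (h n))) => n; case: cid.
  move=> n; have n0 : (0 : R) < n.+1%:R^-1 by rewrite invr_gt0.
  by have [j [y [f [yf ->]]] lt] := inf_adherent n0 infS; exists y, f.
(* the midpoint inequality makes almost minimisers a Cauchy sequence *)
have ycauchy n k : (n <= k)%N -> `|y k - y n| <= Num.sqrt (8 / c * n.+1%:R^-1).
  move=> nk; have [f [yf fm]] := ym n; have [f' [yf' fm']] := ym k.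
  have half01 : 0 <= (2^-1 : R) <= 1 by lra.
  have := phi_convex (y n) (y k) half01.
  rewrite yf yf' -!EFinM -EFinD => /(eR_finite_le (phiN _)) [f'' yf'' le].
  have := mS _ (ex_intro _ _ (ex_intro _ _ (conj yf'' erefl))) => mle.
  have kn : k.+1%:R^-1 <= n.+1%:R^-1 :> R by rewrite lef_pV2 ?posrE// ler_nat.
  rewrite -(ler_pXn2r (_ : (0 < 2)%N)) ?nnegrE ?sqrtr_ge0//.
  rewrite sqr_sqrtr; last first.
    by rewrite mulr_ge0// ?divr_ge0 ?invr_ge0// ltW.
  rewrite -dot_norm.
  have E : q (2^-1 *: y n + (1 - 2^-1) *: y k) = (q (y n) + q (y k)) / 2
     - c / 8 * dot (y k - y n) (y k - y n).
    by rewrite /q !dotE (dotC _ (y k) (y n)); field.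
  rewrite E in mle.
  rewrite -(ler_pM2l (_ : 0 < c / 8)); last lra.
  rewrite mulrA (_ : c / 8 * (8 / c) = 1); last by field; rewrite gt_eqF.
  move: fm fm' kn mle; rewrite mul1r.
  move: (n.+1%:R^-1 : R) (k.+1%:R^-1 : R) => a b; lra.
have rate0 : (fun n => Num.sqrt (8 / c * n.+1%:R^-1)) @ \oo --> (0 : R).
  rewrite -[X in _ --> X](@sqrtr0 R).
  apply: (continuous_cvg _ (@sqrt_continuous R 0)).
  rewrite -[X in _ --> X](mulr0 (8 / c)).
  by apply: cvgM; [exact: cvg_cst|exact: cvg_harmonic].
have [x yx] := cauchy_rate_lim rate0 ycauchy.
have qc : continuous q.
  move=> u; apply: cvgB.
    apply: cvgM; first exact: cvg_cst.
    under eq_fun do rewrite dot_norm.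
    by rewrite dot_norm; apply: cvgM; exact: cvg_norm.
  apply/cvgrPdist_lt => /= e e0.
  have ez : 0 < (`|z| + 1)^-1 * e by rewrite mulr_gt0// invr_gt0 ltr_wpDl.
  apply/nbhs_normP; exists ((`|z| + 1)^-1 * e) => // v /= uv.
  rewrite -(dotNr dot) -dotDr; apply: le_lt_trans (dot_cauchy dot_norm _ _) _.
  apply: (@le_lt_trans _ _ ((`|z| + 1) * `|u - v|)).
    by rewrite ler_wpM2r// lerDl.
  by rewrite -ltr_pdivlMl ?ltr_wpDl.
have ycvg : y @ \oo --> x.
  apply/cvgrPdist_le => e e0.
  have /cvgrPdist_lt/(_ _ e0) [N _ rN] := rate0.
  exists N => // n /= Nn; apply: le_trans (yx n) _.
  by have := rN _ Nn; rewrite sub0r normrN => /ltW; apply: le_trans (ler_norm _).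
have qy : q (y n) @[n --> \oo] --> q x by exact: (cvg_comp _ _ ycvg (qc x)).
have phix : (phi x <= (m - q x)%:E)%E.
  rewrite leNgt; apply/negP => lt.
  have [a [mqa ax]] : exists a, m - q x < a /\ (a%:E < phi x)%E.
    move: lt; case E: (phi x) => [f| |]//=.
      rewrite lte_fin => h; exists ((m - q x + f)/2); rewrite lte_fin; lra.
    by move=> _; exists (m - q x + 1); rewrite ltry; split => //; lra.
  have [W xW aW] := phi_lsc ax.
  have mlim : m + n.+1%:R^-1 - q (y n) @[n --> \oo] --> m + 0 - q x.
    by apply: cvgB => //; apply: cvgD; [exact: cvg_cst|exact: cvg_harmonic].
  rewrite addr0 in mlim.
  have [n [/= mna /aW]] := filter_ex (filterI (cvgr_lt _ mlim _ mqa) (ycvg _ xW)).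
  have [f [-> fm]] := ym n; rewrite lte_fin => af.
  by move: fm mna; move: (n.+1%:R^-1 : R) => b; lra.
have [p xp pm] := eR_finite_le (phiN x) phix.
have mp : m <= p + q x by apply: mS; exists x, p.
exists x => w.
case wf : (phi w) (phiN w) => [f| |]// _; last by rewrite leey.
rewrite xp -EFinD lee_fin.
pose D := c / 2 * dot (w - x) (w - x).
(* minimality on the segment towards [w], divided by [t], lets [t] go to 0 *)
suff h : forall t, 0 < t <= 1 -> p + dot (z - c *: x) (w - x) <= f + t * D.
  have D0 : 0 <= D.
    by rewrite mulr_ge0 ?dot_ge0// divr_ge0// ltW.
  apply/ler_addgt0Pr => e e0.
  have De : 0 < D + e + 1 by lra.
  pose t := Num.min 1 (e / (D + 1)).
  have t1 : 0 < t <= 1.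
    by rewrite /t lt_min ltr01 ge_min lexx andbT divr_gt0//; lra.
  apply: le_trans (h _ t1) _; rewrite lerD2l.
  apply: (@le_trans _ _ (e / (D + 1) * D)).
    by rewrite ler_wpM2r// /t ge_min lexx orbT.
  rewrite mulrAC ler_pdivrMr; last lra.
  by rewrite ler_pM2l// lerDl.
move=> t /andP[t0 t1].
have t01 : 0 <= t <= 1 by rewrite ltW.
have := phi_convex w x t01.
rewrite wf xp -!EFinM -EFinD => /(eR_finite_le (phiN _)) [g wg le].
have := mS _ (ex_intro _ _ (ex_intro _ _ (conj wg erefl))) => mle.
have E : q (t *: w + (1 - t) *: x) = q x - t * dot (z - c *: x) (w - x)
   + t * (t * D).
  by rewrite /q /D !dotE (dotC _ w x); field.
rewrite E in mle.
rewrite -(ler_pM2l t0) !mulrDr.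
lra.
Qed.

End Resolvent.

(** The inclusion solved by the resolvent of the linear function [- l] reads
    [- x] represents [- l]. *)
Lemma riesz_representation (l : {linear H -> R^o}) : continuous l ->
  exists g, forall h, l h = dot g h.
Proof.
move=> lc.
have [K lK] : exists K, forall y, `|l y| <= K * `|y|.
  have /linear_boundedP/pinfty_ex_gt0[M M0 lM] := continuous_linear_bounded 0 (lc 0).
  by exists M => y; exact: lM.
pose phi (y : H) := (- l y)%:E.
have pP : proper_function phi by split => //; exists 0.
have pC : econvex_function phi.
  move=> t x y _; rewrite /phi -!EFinM -EFinD lee_fin.
  have -> : l (t *: x + (1 - t) *: y) = t * l x + (1 - t) * l y :> R.
    by rewrite linearD !linearZ.
  by rewrite opprD !mulrN.
have pL : lower_semicontinuous phi.
  move=> x a; rewrite lte_fin => ax.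
  have h : - l y @[y --> x] --> - l x by apply: cvgN; exact: lc.
  exists [set y | a < - l y]; last by move=> y /=; rewrite lte_fin.
  exact: (cvgr_gt _ h _ ax).
have pB y : ((0 - K * `|y|)%:E <= phi y)%E.
  rewrite lee_fin sub0r lerN2; exact: le_trans (ler_norm _) (lK y).
have [x xs] := resolvent_exists pP pC pL pB 0 (@ltr01 R).
have h d : dot (0 - 1 *: x) d <= - l d.
  have := xs (x + d); rewrite /phi -EFinD lee_fin [x + d]addrC addrK linearD => h.
  rewrite opprD/= in h; lra.
exists x => d; apply/eqP; rewrite eq_le; apply/andP; split.
  by have := h d; rewrite sub0r scale1r dotNl; lra.
by have := h (- d); rewrite sub0r scale1r dotNl dotNr opprK linearN opprK.
Qed.

End ConvexAnalysis.

(** * Subdifferentials and gradients *)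

Section Subdifferential.
Variables (R : realType) (H : completeNormedModType R).
Variable dot : {dot H for idfun}.
Hypothesis dot_norm : forall x : H, dot x x = `|x| ^+ 2.

Lemma cvg_dot (T : Type) (F : set_system T) (FF : Filter F) (u v : T -> H)
    (a b : H) : u @ F --> a -> v @ F --> b ->
  dot (u t) (v t) @[t --> F] --> dot a b.
Proof.
have polar c d : dot c d = (`|c + d| ^+ 2 - `|c| ^+ 2 - `|d| ^+ 2) / 2.
  by rewrite -!dot_norm !dotE (dotC _ d c); field.
move=> ua vb; rewrite polar; under eq_fun do rewrite polar.
apply: cvgM; last exact: cvg_cst.
have sq (w : T -> H) l : w @ F --> l -> `|w t| ^+ 2 @[t --> F] --> `|l| ^+ 2.
  by move=> wl; apply: cvgM; exact: cvg_norm.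
by apply: cvgB; [apply: cvgB|]; apply: sq => //; exact: cvgD.
Qed.

Variable phi : H -> \bar R.
Hypothesis phi_proper : proper_function phi.

Lemma subdifferential_fin x v : subdifferential dot phi x v ->
  exists p, phi x = p%:E.
Proof.
have [phiN [y0 phiy0]] := phi_proper.
move=> /(_ y0); case: (phi x) (phiN x) => [p| |]// _; first by exists p.
by rewrite addye// leye_eq (negPf phiy0).
Qed.

Lemma subdifferential_monotone x y v w :
  subdifferential dot phi x v -> subdifferential dot phi y w ->
  0 <= dot (x - y) (v - w).
Proof.
move=> xv yw; have [p xp] := subdifferential_fin xv.
have [q yq] := subdifferential_fin yw.
have := xv y; have := yw x; rewrite xp yq -!EFinD !lee_fin.
by rewrite !dotE (dotC dot x v) (dotC dot x w) (dotC dot y v) (dotC dot y w); lra.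
Qed.

(** Strong convergence of both arguments suffices: lower semicontinuity handles
    [phi] and the pairing converges. *)
Lemma subdifferential_closed (u w : nat -> H) x v :
  lower_semicontinuous phi -> u @ \oo --> x -> w @ \oo --> v ->
  (forall n, subdifferential dot phi (u n) (w n)) ->
  subdifferential dot phi x v.
Proof.
move=> phi_lsc ux wv uw y.
have [phiN _] := phi_proper.
case yf : (phi y) (phiN y) => [f| |]// _; last by rewrite leey.
suff : (phi x <= (f - dot v (y - x))%:E)%E.
  case: (phi x) (phiN x) => [p| |]//= _; rewrite -EFinD !lee_fin; lra.
rewrite leNgt; apply/negP => lt.
have [a [fa ax]] : exists a, f - dot v (y - x) < a /\ (a%:E < phi x)%E.
  move: lt; case: (phi x) => [p| |]//=.
    by rewrite lte_fin => h; exists ((f - dot v (y - x) + p)/2);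
       rewrite lte_fin; lra.
  by move=> _; exists (f - dot v (y - x) + 1); rewrite ltry; split => //; lra.
have [W xW aW] := phi_lsc _ _ ax.
have lim : f - dot (w n) (y - u n) @[n --> \oo] --> f - dot v (y - x).
  apply: cvgB; first exact: cvg_cst.
  by apply: cvg_dot => //; apply: cvgB => //; exact: cvg_cst.
have [n [/= lta /aW]] := filter_ex (filterI (cvgr_lt _ lim _ fa) (ux _ xW)).
have [p unp] := subdifferential_fin (uw n).
by have := uw n y; rewrite unp yf -EFinD !lee_fin lte_fin; lra.
Qed.

End Subdifferential.

Section Gradient.
Variables (R : realType) (H : completeNormedModType R).
Variable dot : {dot H for idfun}.
Hypothesis dot_norm : forall x : H, dot x x = `|x| ^+ 2.
Variable psi : H -> R^o.
Hypothesis psi_diff : forall x : H, differentiable psi x.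

(** Riesz representation ensures that [gradient] has a vector to choose. *)
Lemma gradientP x h : 'd psi x h = dot (gradient dot psi x) h.
Proof.
rewrite /gradient; case: xgetP => [g _ ->//|].
have [g gP] := riesz_representation dot_norm (diff_continuous (psi_diff x)).
by move=> /(_ g).
Qed.

Lemma gradient_convex_le x y :
  convex_function [set: convex_lmodType H] psi ->
  psi x + dot (gradient dot psi x) (y - x) <= psi y.
Proof.
move=> psi_convex; rewrite -gradientP -deriveE// -lerBrDl.
have /cvg_ex[l dl] : derivable psi x (y - x) by exact: diff_derivable.
rewrite /derive (cvg_lim _ dl)//.
have := cvg_dnbhs_at_right dl; set Q := (X in X --> _) => dl'.
rewrite -(cvg_lim (@Rhausdorff R) dl').
apply: limr_le; first by apply/cvg_ex; exists l.
near=> h.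
have h0 : 0 < h by near: h; exact: nbhs_right_gt.
have h1 : h <= 1 by near: h; exact: nbhs_right_ltW.
rewrite /GRing.scale/= ler_pdivrMl//.
have := psi_convex (Itv01 (ltW h0) h1) y x; rewrite !inE => /(_ Logic.I Logic.I).
rewrite convRE/=.
have -> : conv (Itv01 (ltW h0) h1) (y : convex_lmodType H) (x : convex_lmodType H)
    = h *: (y - x) + x.
  rewrite scalerBr addrAC -addrA -[X in _ + (X - _)]scale1r -scalerBl.
  by [].
move=> le.
by have : psi (h *: (y - x) + x) <= h * psi y + (1 - h) * psi x by []; lra.
Unshelve. all: by end_near. Qed.

End Gradient.

(** * Superadditive interval functions and Vitali covering *)

Section Superadditive.
Variables (R : realType) (G : R -> R -> R).
Hypothesis G_ge0 : forall a b, a <= b -> 0 <= G a b.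
Hypothesis G_superadditive : forall a c b, a <= c -> c <= b ->
  G a c + G c b <= G a b.
Local Notation mu := (@lebesgue_measure R).

(** Pick one interval: the others lie to its left or to its right, and
    superadditivity splits [a, b] accordingly. *)
Lemma superadditive_packing (I : eqType) (l r : I -> R) (s : seq I) (a b : R) :
  a <= b -> uniq s ->
  {in s, forall i, [/\ a <= l i, l i <= r i & r i <= b]} ->
  {in s &, forall i j, i != j -> r i < l j \/ r j < l i} ->
  \sum_(i <- s) G (l i) (r i) <= G a b.
Proof.
have [n sn] : exists n, size s = n by exists (size s).
elim/ltn_ind : n s sn a b => n IH s sn a b ab us.
case: s sn us => [|i s] sn us lr sep; first by rewrite big_nil G_ge0.
rewrite big_cons (bigID (fun j => r j < l i))/= -!(big_filter s).
have [ali liri rib] := lr i (mem_head _ _).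
move: us => /=/andP[iNs us].
have sepi j : j \in s -> (r j < l i) = false -> r i < l j.
  move=> js h; have ij : i != j by apply: contraNneq iNs => ->.
  by case: (sep i j (mem_head _ _) _ ij); rewrite ?inE ?js ?orbT// h.
have szf (P : pred I) : (size [seq x <- s | P x] < n)%N.
  by rewrite -sn ltnS size_filter count_size.
have lrs j : j \in s -> [/\ a <= l j, l j <= r j & r j <= b].
  by move=> js; apply: lr; rewrite inE js orbT.
have seps (P : pred I) :
    {in [seq x <- s | P x] &, forall i j, i != j -> r i < l j \/ r j < l i}.
  move=> j k; rewrite !mem_filter => /andP[_ js] /andP[_ ks].
  by apply: sep; rewrite inE ?js ?ks orbT.
have h1 : \sum_(j <- [seq j <- s | r j < l i]) G (l j) (r j) <= G a (l i).
  apply: (IH _ (szf _)) => //; first exact: filter_uniq.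
  move=> j; rewrite mem_filter => /andP[rl /lrs[k1 k2 k3]]; split => //; exact: ltW.
have h2 : \sum_(j <- [seq j <- s | ~~ (r j < l i)]) G (l j) (r j) <= G (r i) b.
  apply: (IH _ (szf _)) => //; first exact: filter_uniq.
  move=> j; rewrite mem_filter => /andP[/negbTE rl js].
  by have [k1 k2 k3] := lrs _ js; split => //; apply/ltW/sepi.
have := G_superadditive ali (le_trans liri rib).
have := G_superadditive liri rib.
lra.
Qed.

(** Weak type estimate for the maximal function of [G]: by Vitali's covering
    lemma the heavy intervals are covered by the fivefold enlargements of
    disjoint ones, whose total weight is at most [G a b]. *)
Lemma superadditive_maximal (a b eps : R) : a <= b -> 0 < eps ->
  exists U : set R, [/\ measurable U, (mu U <= (5 * G a b / eps)%:E)%E &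
    forall c r t, 0 < r -> a <= c - r -> c + r <= b ->
      eps * (2 * r) <= G (c - r) (c + r) -> c - r <= t <= c + r -> U t].
Proof.
move=> ab eps0.
(* Vitali's lemma asks every indexed ball to be nondegenerate, hence the
   default radius 1 *)
pose rad (p : R * R) := if 0 < p.2 then p.2 else 1.
pose B (p : R * R) := ball p.1 (rad p).
pose V := [set p : R * R | [/\ 0 < p.2, a <= p.1 - p.2, p.1 + p.2 <= b &
   eps * (2 * p.2) <= G (p.1 - p.2) (p.1 + p.2)]].
have rad0 p : 0 < rad p by rewrite /rad; case: ifPn.
have Vrad p : V p -> rad p = p.2 by move=> [p0 _ _ _]; rewrite /rad p0.
have radB p : (radius (B p))%:num = rad p by rewrite radius_ball_num// ltW.
have cB p : closure (B p) = closed_ball p.1 (rad p) by [].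
have Vb p : V p -> (radius (B p))%:num <= b - a.
  by move=> Vp; rewrite radB (Vrad _ Vp); case: Vp; lra.
have radB0 p : 0 < (radius (B p))%:num by rewrite radB.
have isB p : is_ball (B p) by exact: is_ball_ball.
have [D [cD DV tD cov]] := vitali_lemma_infinite_cover isB radB0 Vb.
have [f f_inj] := elimT (countable_injP _) cD.
(* enumerating the countable disjoint family without repetition keeps its
   finite parts disjoint *)
have [g gP] : exists g : nat -> option (R * R),
    forall n p, g n = Some p <-> D p /\ f p = n.
  exists (fun n => if pselect (exists p, D p /\ f p = n) is left e
                   then Some (projT1 (cid e)) else None) => n p.
  case: pselect => [e|ne].
    case: cid => /= q [Dq fq]; split => [[<-]//|[Dp fp]].
    by congr Some; apply: f_inj; rewrite ?inE// fq.
  by split => // h; case: ne; exists p.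
pose F n := if g n is Some p then closed_ball p.1 (5 * p.2) else set0.
have r0 n p : g n = Some p -> 0 < p.2 by move=> /gP[/DV[]].
have muF n : mu (F n) = (if g n is Some p then 10 * p.2 else 0)%:E.
  rewrite /F; case gn : (g n) => [p|]; last exact: measure0.
  have := r0 _ _ gn => p0.
  rewrite lebesgue_measure_closed_ball ?mulr_ge0// ?ltW//.
  by congr (_%:E); rewrite -mulr_natr; ring.
have mF n : measurable (F n).
  by rewrite /F; case: (g n) => // p; exact: measurable_realfun.measurable_closed_ball.
have mU : measurable (\bigcup_n F n) by exact: bigcupT_measurable.
exists (\bigcup_n F n); split => //.
  have := @measure_sigma_subadditive _ _ _ mu _ F mF mU (@subset_refl _ _).
  move=> /le_trans; apply.
  apply: lime_le; first exact: is_cvg_nneseries.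
  apply: nearW => N; rewrite (eq_bigr _ (fun n _ => muF n)).
  rewrite sumEFin lee_fin big_mkord.
  rewrite -(big_mkord xpredT (fun n => if g n is Some p then 10 * p.2 else 0)).
  rewrite /index_iota subn0.
  have -> : \sum_(i <- iota 0 N) (if g i is Some p then 10 * p.2 else 0)
      = 5 * (\sum_(p <- pmap g (iota 0 N)) 2 * p.2).
    elim: (iota 0 N) => [|n s IHs]; first by rewrite !big_nil mulr0.
    rewrite big_cons IHs /=; case: (g n) => [p|]/=; rewrite ?big_cons; ring.
  rewrite -mulrA ler_pM2l// ler_pdivlMr// mulrC mulr_sumr.
  have sD p : p \in pmap g (iota 0 N) -> D p.
    by rewrite mem_pmap => /mapP[n _ /esym/gP[]].
  apply: (@le_trans _ _ (\sum_(p <- pmap g (iota 0 N)) G (p.1 - p.2) (p.1 + p.2))).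
    rewrite big_seq [leRHS]big_seq; apply: ler_sum => p /sD/DV[]//.
  apply: superadditive_packing => //.
  - rewrite (@pmap_uniq _ _ _ f)// ?iota_uniq// => n.
    by case gn : (g n) => [p|]//=; have /gP[_ ->] := gn.
  - by move=> p /sD/DV[p0 k1 k2 _]; split => //; lra.
  move=> p q /sD Dp /sD Dq pq.
  apply: contrapT => /not_orP[/negP + /negP]; rewrite -!leNgt => h1 h2.
  have [Vp Vq] := (DV _ Dp, DV _ Dq).
  have [[p0 _ _ _] [q0 _ _ _]] := (Vp, Vq).
  have /eqP := pq; apply; apply: tD => //.
  exists (Num.max (p.1 - p.2) (q.1 - q.2)); rewrite /= !cB !closed_ball_itv//.
  rewrite (Vrad _ Vp) (Vrad _ Vq).
  by split; rewrite /= in_itv/= le_max ge_max ?lexx ?orbT/=;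
    apply/andP; split; lra.
move=> c r t rp ac cb Gcr tcr.
have Vcr : V (c, r) by [].
have : cover V (closure \o B) t.
  by exists (c, r) => //; rewrite /comp cB closed_ball_itv// (Vrad _ Vcr) /= in_itv.
move=> /cov[p Dp] /=.
have Vp := DV _ Dp; have [p0 _ _ _] := Vp.
rewrite /B scale_ballE// => tp; exists (f p) => //.
rewrite /F; have -> : g (f p) = Some p by apply/gP.
by rewrite -(Vrad _ Vp).
Qed.

End Superadditive.

(** * Lipschitz curves in a Hilbert space are differentiable almost everywhere *)

Section LipschitzCurve.
Variables (R : realType) (H : completeNormedModType R).
Variable dot : {dot H for idfun}.
Hypothesis dot_norm : forall x : H, dot x x = `|x| ^+ 2.
Variables (x : R -> H) (L : R).
Hypothesis x_lip : forall s t, `|x t - x s| <= L * `|t - s|.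
Local Notation mu := (@lebesgue_measure R).

(** The sums [\sum |x t_(i+1) - x t_i|^2 / (t_(i+1) - t_i)] over subdivisions
    of [[a, b]], generated by concatenation. *)
Inductive energy_sum : R -> R -> R -> Prop :=
| energy_sum_one a b : a < b -> energy_sum a b (`|x b - x a| ^+ 2 / (b - a))
| energy_sum_cat a c b s t : energy_sum a c s -> energy_sum c b t ->
    energy_sum a b (s + t).

(** It is [0] on degenerate intervals, the supremum of the empty set being
    [0]. *)
Definition energy a b := sup [set s | energy_sum a b s].

Lemma energy_sum_lt a b s : energy_sum a b s -> a < b.
Proof. by elim=> // {}a c {}b u v _ ac _; exact: lt_trans. Qed.

Lemma energy_sum_le a b s : energy_sum a b s -> s <= L ^+ 2 * (b - a).
Proof.
elim=> [{}a {}b ab|{}a c {}b u v _ hu _ hv]; last by lra.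
have ba : 0 < b - a by rewrite subr_gt0.
rewrite ler_pdivrMr// -mulrA -expr2 -exprMn.
have lab : `|x b - x a| <= L * (b - a).
  by have := x_lip a b; rewrite (gtr0_norm ba).
by rewrite ler_pXn2r ?nnegrE//; exact: le_trans lab.
Qed.

Lemma energy_has_sup a b : a < b -> has_sup [set s | energy_sum a b s].
Proof.
move=> ab; split; first by eexists; exact: (energy_sum_one ab).
by exists (L ^+ 2 * (b - a)) => s /energy_sum_le.
Qed.

Lemma energy_ub a b s : energy_sum a b s -> s <= energy a b.
Proof.
by move=> h; apply: ub_le_sup => //; have [] := energy_has_sup (energy_sum_lt h).
Qed.

Lemma energyxx a : energy a a = 0.
Proof.
rewrite /energy (_ : [set s | _] = set0) ?sup0//.
by rewrite -subset0 => s /energy_sum_lt; rewrite ltxx.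
Qed.

Lemma energy_superadditive a c b : a <= c -> c <= b ->
  energy a c + energy c b <= energy a b.
Proof.
rewrite [a <= c]le_eqVlt => /predU1P[->|ac]; first by rewrite energyxx add0r.
rewrite [c <= b]le_eqVlt => /predU1P[->|cb]; first by rewrite energyxx addr0.
apply/ler_addgt0Pr => e e0.
have e2 : 0 < e / 2 by rewrite divr_gt0.
have [s hs ls] := sup_adherent e2 (energy_has_sup ac).
have [t ht lt] := sup_adherent e2 (energy_has_sup cb).
have := energy_ub (energy_sum_cat hs ht).
by rewrite /energy in ls lt *; lra.
Qed.

(** The energy of the curve [t |-> x t - t *: m]: expanding the squares, the
    correction to [energy] telescopes. *)
Definition energy_shift (m : H) a b :=
  energy a b - 2 * dot m (x b - x a) + `|m| ^+ 2 * (b - a).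

Lemma energy_shift_ge m a b : a < b ->
  `|x b - x a - (b - a) *: m| ^+ 2 / (b - a) <= energy_shift m a b.
Proof.
move=> ab; have := energy_ub (energy_sum_one ab).
have ba : 0 < b - a by rewrite subr_gt0.
rewrite /energy_shift -!dot_norm => h.
suff -> : dot (x b - x a - (b - a) *: m) (x b - x a - (b - a) *: m) / (b - a) =
  dot (x b - x a) (x b - x a) / (b - a) - 2 * dot m (x b - x a)
  + dot m m * (b - a) by lra.
move: (x b - x a) h => d h; rewrite !dotE (dotC _ d m); field.
by rewrite gt_eqF.
Qed.

Lemma energy_shift_ge0 m a b : a <= b -> 0 <= energy_shift m a b.
Proof.
rewrite le_eqVlt => /predU1P[->|ab].
  by rewrite /energy_shift energyxx !subrr -(scale0r (0 : H)) dotZr; lra.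
apply: le_trans (energy_shift_ge m ab).
by rewrite divr_ge0 ?exprn_ge0// subr_ge0 ltW.
Qed.

Lemma energy_shift_superadditive m a c b : a <= c -> c <= b ->
  energy_shift m a c + energy_shift m c b <= energy_shift m a b.
Proof.
move=> ac cb; have := energy_superadditive ac cb.
by rewrite /energy_shift !dotE; lra.
Qed.

(** Subtracting the chord leaves exactly the energy that the one-interval
    subdivision misses. *)
Lemma energy_shift_slope a b : a < b ->
  energy_shift ((b - a)^-1 *: (x b - x a)) a b =
  energy a b - `|x b - x a| ^+ 2 / (b - a).
Proof.
move=> ab; have ba : 0 < b - a by rewrite subr_gt0.
rewrite /energy_shift -!dot_norm; move: (x b - x a) => d.
by rewrite !dotE; field; rewrite gt_eqF.
Qed.

(** On each interval of the subdivision, apply the maximal estimate to the curve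
    minus its chord: off a set whose measure is controlled by the energy that
    the subdivision misses, the difference quotients at [t] are close to the
    slope [m] of the chord. *)
Lemma chord_approximation a b s (eps : R) : 0 < eps -> energy_sum a b s ->
  exists U : set R, [/\ measurable U,
    (mu U <= (5 * (energy a b - s) / eps ^+ 2)%:E)%E &
    forall t, a < t < b -> ~ U t -> exists m : H, exists2 rho : R, 0 < rho &
      forall h, 0 < `|h| < rho -> `|h^-1 *: (x (t + h) - x t) - m| < eps].
Proof.
move=> eps0; elim=> [{}a {}b ab|{}a c {}b u v hu [U [mU muU hU]] hv [W [mW muW hW]]].
  pose m := (b - a)^-1 *: (x b - x a).
  have [U [mU muU hU]] := superadditive_maximal (energy_shift_ge0 m)
    (@energy_shift_superadditive m) (ltW ab) (exprn_gt0 2 eps0).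
  exists U; split => //; first by rewrite -energy_shift_slope.
  move=> t /andP[at_ tb] Ut; exists m; exists (Num.min (t - a) (b - t)).
    by rewrite lt_min !subr_gt0 at_.
  have key p q : a <= p -> p < q -> q <= b -> p <= t <= q ->
      `|(q - p)^-1 *: (x q - x p) - m| < eps.
    move=> ap pq qb tpq; have qp : 0 < q - p by rewrite subr_gt0.
    rewrite ltNge; apply/negP => le; apply: Ut.
    apply: (hU ((p + q) / 2) ((q - p) / 2)).
    - by rewrite divr_gt0.
    - lra.
    - lra.
    - have -> : (p + q) / 2 - (q - p) / 2 = p by field.
      have -> : (p + q) / 2 + (q - p) / 2 = q by field.
      have -> : 2 * ((q - p) / 2) = q - p by field.
      apply: le_trans (energy_shift_ge m pq).
      rewrite ler_pdivlMr// -mulrA -expr2 -exprMn.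
      rewrite ler_pXn2r ?nnegrE//; last by rewrite mulr_ge0// ltW.
      rewrite -ler_pdivlMr// mulrC; apply: le_trans le _.
      have -> : (q - p)^-1 *: (x q - x p) - m =
          (q - p)^-1 *: (x q - x p - (q - p) *: m).
        by rewrite [RHS]scalerBr scalerA mulVf ?scale1r// gt_eqF.
      by rewrite normrZ gtr0_norm// invr_gt0.
    - by move: tpq; lra.
  move=> h /andP[h0]; rewrite lt_min => /andP[hl hr].
  have [hp|hn|h00] := ltgtP h 0; last by rewrite h00 normr0 ltxx in h0.
    rewrite (ltr0_norm hp) in hl hr.
    have := key (t + h) t; rewrite (_ : t - (t + h) = - h); last by ring.
    rewrite invrN scaleNr -scalerN opprB; apply; lra.
  rewrite (gtr0_norm hn) in hl hr.
  have := key t (t + h); rewrite (_ : t + h - t = h); last by ring.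
  apply; lra.
exists (U `|` W `|` [set c]); split.
- by apply: measurableU => //; exact: measurableU.
- have mUW : measurable (U `|` W) by exact: measurableU.
  have := @measureU2 _ _ _ mu _ _ mUW (measurable_set1 c).
  have muc : mu [set c] = 0%E by exact: lebesgue_measure_set1.
  rewrite [X in (_ <= _ + X)%E]muc adde0 => /le_trans; apply.
  have := @measureU2 _ _ _ mu _ _ mU mW; move=> /le_trans; apply.
  apply: le_trans (leeD muU muW) _.
  rewrite -EFinD lee_fin -mulrDl ler_wpM2r ?invr_ge0 ?sqr_ge0//.
  have := energy_superadditive (ltW (energy_sum_lt hu)) (ltW (energy_sum_lt hv)).
  lra.
move=> t /andP[at_ tb] /not_orP[/not_orP[tU tW] tc].
have [lt|lt|] := ltgtP t c; last by move/tc.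
  by apply: hU => //; rewrite at_.
by apply: hW => //; rewrite lt.
Qed.

(** Subdivisions of nearly maximal energy make the exceptional sets arbitrarily
    small, so almost everywhere the difference quotients are Cauchy. The inner
    product enters through the Pythagorean identity behind [energy_shift]. *)
Theorem lipschitz_curve_ae_derivable a b :
  {ae mu, forall t, a < t < b -> derivable x t 1}.
Proof.
have [ba|ab] := leP b a.
  by apply: aeW => t /andP[]; lra.
pose good eps t := exists m : H, exists2 rho : R, 0 < rho &
  forall h, 0 < `|h| < rho -> `|h^-1 *: (x (t + h) - x t) - m| < eps.
(* the exceptional set lies in sets [U k] of measure at most [1 / (k + 1)] *)
have negl n : mu.-negligible [set t | a < t < b /\ ~ good n.+1%:R^-1 t].
  have e0 : (0 : R) < n.+1%:R^-1 by rewrite invr_gt0.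
  have [U hU] : {U : nat -> set R & forall k, [/\ measurable (U k),
      (mu (U k) <= (k.+1%:R^-1)%:E)%E &
      [set t | a < t < b /\ ~ good n.+1%:R^-1 t] `<=` U k]}.
    suff h k : exists U : set R, [/\ measurable U, (mu U <= (k.+1%:R^-1)%:E)%E &
      [set t | a < t < b /\ ~ good n.+1%:R^-1 t] `<=` U].
      by exists (fun k => projT1 (cid (h k))) => k; case: cid.
    pose d : R := n.+1%:R^-1 ^+ 2 / 5 * k.+1%:R^-1.
    have d0 : 0 < d by rewrite mulr_gt0 ?invr_gt0// divr_gt0// exprn_gt0.
    have [s hs ls] := sup_adherent d0 (energy_has_sup ab).
    have [U [mU muU hU]] := chord_approximation e0 hs.
    exists U; split => //.
      apply: le_trans muU _; rewrite lee_fin ler_pdivrMr ?exprn_gt0//.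
      rewrite -/(energy a b) /d in ls.
      move: ls; move: (n.+1%:R^-1 ^+ 2 : R) (k.+1%:R^-1 : R) => p q; lra.
    move=> t [tab ng]; apply: contrapT => Ut; apply: ng; exact: hU.
  exists (\bigcap_k U k); split.
  - by apply: bigcapT_measurable => k; have [] := hU k.
  - apply/eqP; rewrite eq_le measure_ge0 andbT.
    apply/lee_addgt0Pr => e e_gt0; rewrite add0e.
    have [k _ ke] : exists2 k, True & k.+1%:R^-1 <= e.
      have /cvgrPdist_lt/(_ _ e_gt0)[k _ hk] := @cvg_harmonic R.
      exists k => //; have := hk k (leqnn k); rewrite sub0r normrN => h.
      by rewrite ltW// (le_lt_trans (ler_norm _) h).
    have [mUk muUk _] := hU k.
    apply: (@le_trans _ _ (mu (U k))).
      apply: le_measure; rewrite ?inE//.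
        by apply: bigcapT_measurable => j; have [] := hU j.
      by move=> t; apply.
    by apply: le_trans muUk _; rewrite lee_fin.
  by move=> t ht k _; have [_ _] := hU k; apply.
apply: negligibleS (negligible_bigcup negl) => t /= /not_implyP[tab ndt].
apply: contrapT => nt; apply: ndt.
have goodt n : good n.+1%:R^-1 t.
  by apply: contrapT => ng; apply: nt; exists n.
apply/cauchy_cvgP/cauchy_exP => e e0.
have /cvgrPdist_lt/(_ _ e0)[n _ hn] := @cvg_harmonic R.
have [m [rho rho0 hm]] := goodt n.
exists m; rewrite /fmap/= near_simpl.
apply/nbhs_normP; exists rho => // h /=; rewrite sub0r normrN => hr h0.
rewrite -ball_normE/= distrC scaler1 [h + t]addrC.
apply: lt_trans (hm _ _) _; first by rewrite normr_gt0 h0.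
by have := hn n (leqnn n); rewrite sub0r normrN; exact: le_lt_trans (ler_norm _).
Qed.

End LipschitzCurve.

(** * Absolutely continuous curves *)

Section CurveDerivative.
Variables (R : realType) (V : normedModType R).
Implicit Types (f : R -> V) (t : R).

Lemma derivable_firstorder f t (eps : R) : derivable f t 1 -> 0 < eps ->
  exists2 rho : R, 0 < rho & forall h, `|h| < rho ->
    `|f (t + h) - f t - h *: derive1 f t| <= eps * `|h|.
Proof.
rewrite derive1E /derive => df e0.
have /cvgrPdist_le/(_ _ e0) := df.
move=> /nbhs_normP[rho /= rho0 hr]; exists rho => // h hrho.
have [->|h0] := eqVneq h 0.
  by rewrite addr0 subrr scale0r subr0 !normr0 mulr0.
have := hr h; rewrite /= sub0r normrN scaler1 => /(_ hrho h0).
set d := lim _ => le.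
have -> : f (t + h) - f t - h *: d = h *: (h^-1 *: (f (h + t) - f t) - d).
  by rewrite [RHS]scalerBr scalerA divff// scale1r [h + t]addrC.
by rewrite normrZ mulrC ler_wpM2r// distrC.
Qed.

Lemma firstorder_derivable f t (d : V) :
  (forall eps : R, 0 < eps -> exists2 rho : R, 0 < rho & forall h, `|h| < rho ->
    `|f (t + h) - f t - h *: d| <= eps * `|h|) ->
  derivable f t 1 /\ derive1 f t = d.
Proof.
move=> fo.
have cv : h^-1 *: ((f \o shift t) (h *: 1) - f t) @[h --> 0^'] --> d.
  apply/cvgrPdist_le => e e0; have [rho rho0 hr] := fo _ e0.
  apply/nbhs_normP; exists rho => // h /=.
  rewrite sub0r normrN scaler1 => hrho h0.
  have -> : d - h^-1 *: (f (h + t) - f t) =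
      - (h^-1 *: (f (t + h) - f t - h *: d)).
    by rewrite [h^-1 *: (_ - h *: d)]scalerBr scalerA mulVf// scale1r
      [h + t]addrC opprB.
  rewrite normrN normrZ normfV ler_pdivrMl ?normr_gt0// mulrC.
  exact: hr.
split; first by apply/cvg_ex; exists d.
by rewrite derive1E; apply: cvg_lim cv; exact: norm_hausdorff.
Qed.

End CurveDerivative.

Section AbsolutelyContinuous.
Variable R : realType.
Local Notation mu := (@lebesgue_measure R).

(** The supremum of the points where [P] holds is reached from the left by the
    local step, and passed unless it is [b]. *)
Lemma cousin_induction (P : R -> Prop) (a b : R) : a <= b -> P a ->
  (forall s, a <= s <= b -> exists2 rho : R, 0 < rho & forall p q,
     a <= p -> p <= s -> s <= q -> q <= b -> s - rho < p -> q < s + rho ->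
     P p -> P q) ->
  P b.
Proof.
move=> ab Pa step.
pose S := [set t | a <= t <= b /\ P t].
have Sa : S a by split => //; rewrite lexx.
have hS : has_sup S by split; [exists a|exists b => t [/andP[]]].
have asup : a <= sup S by apply: ub_le_sup => //; case: hS.
have supb : sup S <= b by apply: ge_sup; [case: hS|move=> t [/andP[]]].
have [|rho rho0 hrho] := step (sup S); first by rewrite asup.
have [p [/andP[ap pb] Pp] lp] := sup_adherent rho0 hS.
have ps : p <= sup S by apply: ub_le_sup; [case: hS|split => //; rewrite ap].
have [bs|sb] := ltP b (sup S + rho); first exact: (hrho p b).
have Pq : P (sup S + rho / 2).
  by apply: (hrho p) => //; lra.
have : sup S + rho / 2 <= sup S.
  by apply: ub_le_sup; [case: hS|split => //; apply/andP; split; lra].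
lra.
Qed.

Lemma lipschitz_absolutely_continuous (V : normedModType R) (a b L : R)
    (f : R -> V) :
  (forall s t, a <= s -> s <= t -> t <= b -> `|f t - f s| <= L * (t - s)) ->
  absolutely_continuous a b f.
Proof.
move=> lipf e e0; exists (e / (`|L| + 1)).
  by rewrite divr_gt0// ltr_wpDl.
move=> n l r lr _; rewrite ltr_pdivlMr ?ltr_wpDl// => lt.
apply: le_lt_trans lt; rewrite mulr_suml; apply: ler_sum => i _.
have [al lri rb] := lr i; apply: le_trans (lipf _ _ al lri rb) _.
rewrite mulrC ler_wpM2l ?subr_ge0//.
by rewrite ler_wpDr// ler_norm.
Qed.

Lemma absolutely_continuousS (V : normedModType R) (a b c d : R) (f : R -> V) :
  a <= c -> d <= b -> absolutely_continuous a b f ->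
  absolutely_continuous c d f.
Proof.
move=> ac db acf e e0; have [del del0 h] := acf _ e0.
exists del => // n l r lr; apply: h => i; have [cl lri rd] := lr i.
by split => //; lra.
Qed.

Lemma disjoint_itv_sum_le (U : set R) (s : seq (R * R)) (d : R) :
  measurable U -> (mu U <= d%:E)%E ->
  (forall p, p \in s -> p.1 <= p.2 /\ `]p.1, p.2[ `<=` U) ->
  trivIset [set: 'I_(size s)]
    (fun i => `](nth (0, 0) s i).1, (nth (0, 0) s i).2[%classic) ->
  \sum_(i < size s) ((nth (0, 0) s i).2 - (nth (0, 0) s i).1) <= d.
Proof.
move=> mU muU sU tI; rewrite -lee_fin; apply: le_trans muU.
pose F (i : 'I_(size s)) := `](nth (0, 0) s i).1, (nth (0, 0) s i).2[%classic.
have mF i : measurable (F i) by exact: measurable_itv.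
have muF i : mu (F i) = ((nth (0, 0) s i).2 - (nth (0, 0) s i).1)%:E.
  rewrite lebesgue_measure_itv/= lte_fin; case: ltP => //.
  have [] := sU _ (mem_nth (0, 0) (ltn_ord i)); move=> le1 _ le2.
  by congr (_%:E); apply/esym/eqP; rewrite subr_eq0 eq_le le2 le1.
rewrite -sumEFin -(eq_bigr _ (fun i _ => muF i)).
rewrite -(@measure_bigsetU_ord _ _ _ mu _ xpredT F)//.
have mB : measurable (\big[setU/set0]_(i < size s) F i).
  by apply: bigsetU_measurable => i _; exact: mF.
apply: le_measure; rewrite ?inE//.
apply: (@big_ind _ (fun A => A `<=` U) set0 setU) => [t []|A B AU BU|i _].
  by move=> t [/AU|/BU].
by have [_] := sU _ (mem_nth (0, 0) (ltn_ord i)).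
Qed.

(** Away from an open set [U] of small measure that covers the exceptional
    null set, the derivative controls the increments over short intervals;
    inside [U], absolute continuity does. Cousin's argument glues the two. *)
Theorem absolutely_continuous_le (V : normedModType R) (a b C : R) (f : R -> V) :
  0 <= C -> a <= b -> absolutely_continuous a b f ->
  {ae mu, forall t, a < t < b -> derivable f t 1 /\ `|derive1 f t| <= C} ->
  `|f b - f a| <= C * (b - a).
Proof.
move=> C0 ab acf [N [mN muN subN]].
apply/ler_addgt0Pr => e e0.
pose e' := e / (b - a + 1).
have e'0 : 0 < e' by rewrite divr_gt0//; lra.
have [|del del0 hdel] := acf (e / (b - a + 1)); first exact: e'0.
pose A := N `|` [set a; b].
have mA : measurable A by apply: measurableU => //; exact: measurableU.
have muA : mu A = 0%E.
  apply: null_set_setU => //; first exact: measurableU.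
  by apply: null_set_setU => //; exact: lebesgue_measure_set1.
have [||U [oU AU muU]] := @lebesgue_regularity_outer R A (del / 2) mA.
- by rewrite [X in (X < _)%E](_ : _ = 0%E) ?ltry.
- by rewrite divr_gt0.
have mU : measurable U by exact: measurable_realfun.open_measurable.
have muUd : (mu U <= (del / 2)%:E)%E.
  have mUA : measurable (U `&` A) by exact: measurableI.
  have -> : mu U = (mu (U `\` A) + mu (U `&` A))%E by exact: measureDI.
  have -> : mu (U `&` A) = 0%E.
    apply/eqP; rewrite eq_le measure_ge0 andbT -muA.
    by apply: le_measure; rewrite ?inE//; exact: subIsetr.
  by rewrite adde0; exact: ltW.
(* [s] lists the intervals inside [U] that the chain from [a] to [t] uses *)
pose inv t := exists s : seq (R * R), [/\
  forall p, p \in s -> [/\ a <= p.1, p.1 <= p.2, p.2 <= t & `]p.1, p.2[ `<=` U],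
  forall i j, (i < j)%N -> (j < size s)%N ->
    (nth (0, 0) s i).2 <= (nth (0, 0) s j).1 &
  `|f t - f a| <= (C + e') * (t - a) + \sum_(p <- s) `|f p.2 - f p.1|].
suff [s [sU sord fb]] : inv b.
  have sz (i : 'I_(size s)) : nth (0, 0) s i \in s by exact: (mem_nth _ (ltn_ord i)).
  have tI : trivIset [set: 'I_(size s)]
      (fun i => `](nth (0, 0) s i).1, (nth (0, 0) s i).2[%classic).
    apply/trivIsetP => i j _ _; wlog ij : i j / (i < j)%N.
      move=> hw; rewrite neq_ltn => /orP[]h.
        by apply: hw => //; rewrite neq_ltn h.
      by rewrite setIC; apply: hw => //; rewrite neq_ltn h.
    move=> _; rewrite -subset0 => t []; rewrite /= !in_itv/= => /andP[_ h1] /andP[h2 _].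
    have := sord _ _ ij (ltn_ord j); lra.
  have slt : \sum_(i < size s) ((nth (0, 0) s i).2 - (nth (0, 0) s i).1) < del.
    apply: (@le_lt_trans _ _ (del / 2)); last by lra.
    by apply: (disjoint_itv_sum_le mU muUd _ tI) => p /sU[].
  have lr (i : 'I_(size s)) : [/\ a <= (nth (0, 0) s i).1,
      (nth (0, 0) s i).1 <= (nth (0, 0) s i).2 & (nth (0, 0) s i).2 <= b].
    by have [] := sU _ (sz i).
  have lt := hdel _ _ _ lr tI slt.
  move: fb; rewrite (big_nth (0, 0)) big_mkord => fb.
  have : (C + e') * (b - a) + e / (b - a + 1) = C * (b - a) + e.
    by rewrite /e'; field; lra.
  by move: lt fb; rewrite /=; lra.
apply: (@cousin_induction inv a b) => //.
  exists [::]; split => //; by rewrite big_nil !subrr normr0 mulr0 addr0.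
move=> t /andP[at_ tb].
(* a step around a point of [A] stays in [U] and is recorded in [s]; a step
   around any other point obeys the bound on the derivative *)
have [tA|tA] := pselect (A t).
  have /nbhs_normP[rho rho0 hrho] := open_nbhs_nbhs (conj oU (AU _ tA)).
  exists rho => // p q ap pt tq qb lp qr [s [sU sord fp]].
  exists (rcons s (p, q)); split.
  - move=> r; rewrite mem_rcons inE => /predU1P[->|/sU[h1 h2 h3 h4]].
      split => //=; first exact: le_trans tq.
      move=> u; rewrite /= in_itv/= => /andP[pu uq]; apply: hrho => /=.
      by rewrite ltr_norml; lra.
    by split => //; lra.
  - move=> i j ij; rewrite size_rcons ltnS leq_eqVlt => /predU1P[js|js].
      have is' : (i < size s)%N by rewrite -js.
      rewrite !nth_rcons is' js ltnn eqxx /=.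
      by have [] := sU _ (mem_nth (0, 0) is').
    by rewrite !nth_rcons js (ltn_trans ij js); exact: sord.
  rewrite -cats1 big_cat big_seq1/=.
  have -> : f q - f a = (f p - f a) + (f q - f p).
    by rewrite [RHS]addrC addrA subrK.
  apply: le_trans (ler_normD _ _) _.
  have : (C + e') * (p - a) <= (C + e') * (q - a).
    by rewrite ler_wpM2l; lra.
  lra.
have tint : a < t < b.
  have /not_orP[_ /not_orP[/eqP ta /eqP tb']] := tA.
  by rewrite !lt_neqAle eq_sym ta at_ tb' tb.
have [ft fC] : derivable f t 1 /\ `|derive1 f t| <= C.
  by apply: contrapT => h; apply: tA; left; apply: subN => /= /(_ tint).
have [rho rho0 hrho] := derivable_firstorder ft e'0.
exists rho => // p q ap pt tq qb lp qr [s [sU sord fp]].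
have key u : `|u - t| < rho -> `|f u - f t| <= (C + e') * `|u - t|.
  move=> ut; have := hrho (u - t) ut; rewrite [t + _]addrC subrK => le.
  rewrite mulrDl; have -> : f u - f t =
    (u - t) *: derive1 f t + (f u - f t - (u - t) *: derive1 f t).
    by rewrite [RHS]addrC subrK.
  apply: le_trans (ler_normD _ _) _; apply: lerD => //.
  by rewrite normrZ mulrC ler_wpM2r.
have k1 : `|f t - f p| <= (C + e') * (t - p).
  have tp : `|p - t| = t - p by rewrite distrC ger0_norm// subr_ge0.
  by have := key p; rewrite tp distrC; apply; lra.
have k2 : `|f q - f t| <= (C + e') * (q - t).
  have qt : `|q - t| = q - t by rewrite ger0_norm// subr_ge0.
  by have := key q; rewrite qt; apply; lra.
exists s; split => //.
  by move=> r /sU[h1 h2 h3 h4]; split => //; lra.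
have -> : f q - f a = (f p - f a) + (f t - f p) + (f q - f t).
  by rewrite [RHS]addrC [f p - f a + _]addrC !addrA !subrK.
apply: le_trans (ler_normD _ _) _.
have := ler_normD (f p - f a) (f t - f p).
lra.
Qed.

End AbsolutelyContinuous.

(** * Stability of the discrete equation *)

Section DiscreteScheme.
Variables (R : realType) (H : completeNormedModType R).
Variable dot : {dot H for idfun}.
Hypothesis dot_norm : forall x : H, dot x x = `|x| ^+ 2.

Lemma gronwall_discrete (e A S : nat -> R) n :
  (forall k, (k < n)%N -> A k <= A k.+1) ->
  (forall k, (k < n)%N -> S k <= S k.+1) ->
  (forall k, (k < n)%N ->
    e k.+1 <= expR (A k.+1 - A k) * (e k + (S k.+1 - S k))) ->
  e n <= expR (A n - A 0%N) * (e 0%N + (S n - S 0%N)).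
Proof.
elim: n => [_ _ _|n IH Am Sm step].
  by rewrite !subrr expR0 addr0 mul1r.
have {}IH := IH (fun k h => Am k (ltnW h)) (fun k h => Sm k (ltnW h))
  (fun k h => step k (ltnW h)).
apply: le_trans (step n (ltnSn n)) _.
have -> : A n.+1 - A 0%N = (A n.+1 - A n) + (A n - A 0%N) by ring.
rewrite (expRD (A n.+1 - A n)) -[leRHS]mulrA ler_pM2l ?expR_gt0//.
have An0 : 0 <= A n - A 0%N.
  rewrite subr_ge0; elim: n Am {Sm step IH} => // n IH Am.
  by apply: le_trans (IH (fun k h => Am k (ltnW h))) (Am n _).
have Sn := Sm n (ltnSn n).
have E1 : 1 <= expR (A n - A 0%N) by rewrite -expR0 ler_expR.
have -> : expR (A n - A 0%N) * (e 0%N + (S n.+1 - S 0%N)) =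
  expR (A n - A 0%N) * (e 0%N + (S n - S 0%N)) + expR (A n - A 0%N) * (S n.+1 - S n) by ring.
apply: lerD => //; rewrite -[leLHS]mul1r ler_wpM2r//; lra.
Qed.

(** Expand [|c u + w|^2]: the cross term is nonnegative. *)
Lemma monotone_norm_le (c : R) (u w : H) : 0 <= c -> 0 <= dot u w ->
  c * `|u| <= `|c *: u + w| /\ `|w| <= `|c *: u + w|.
Proof.
move=> c0 uw; have cuw : 0 <= c * dot u w by rewrite mulr_ge0.
have := dot_ge0 dot_norm u; have := dot_ge0 dot_norm w => w0 u0.
have cu0 : 0 <= c * c * dot u u by rewrite !mulr_ge0.
split.
  rewrite -{1}(ger0_norm c0) -normrZ; apply: (ler_norm_dot dot_norm).
  by rewrite !dotE (dotC _ w u); lra.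
by apply: (ler_norm_dot dot_norm); rewrite !dotE (dotC _ w u); lra.
Qed.

Variables (lam nu : R -> R) (c0 : R).
Hypothesis c0_gt0 : 0 < c0.
Hypothesis lam_ge : forall t, c0 <= lam t.
Hypothesis nu_mono : forall s t, s <= t -> nu s <= nu t.
Hypothesis lam_nu : forall s t, s <= t -> `|lam t - lam s| <= nu t - nu s.

Let lam_gt0 t : 0 < lam t := lt_le_trans c0_gt0 (lam_ge t).
Let lam_ge0 t : 0 <= lam t := ltW (lam_gt0 t).

(** The unknown [lam *: u + w] dominates both [u] and [w] by monotonicity, and
    a change of [lam] multiplies it by at most [1 + |d lam| / c0]: this is how
    the total variation of [lam] enters. *)
Lemma scheme_stability (h K : R) (U W D : nat -> H) (S : nat -> R) n :
  0 <= h -> 0 <= K ->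
  U 0%N = 0 -> W 0%N = 0 ->
  (forall k, (k <= n)%N -> 0 <= dot (U k) (W k)) ->
  (forall k, (k < n)%N -> `|D k| <= K * `|lam (k%:R * h) *: U k + W k|) ->
  (forall k, (k < n)%N -> `|lam (k%:R * h) *: (U k.+1 - U k) +
      (W k.+1 - W k) + h *: D k| <= S k.+1 - S k) ->
  let b := expR (K * (n%:R * h) + (nu (n%:R * h) - nu 0) / c0) * (S n - S 0%N) in
  `|U n| <= b / c0 /\ `|W n| <= b.
Proof.
move=> h0 K0 U0 W0 UW DK step b.
pose e k := `|lam (k%:R * h) *: U k + W k|.
pose A k := K * (k%:R * h) + nu (k%:R * h) / c0.
have kh k : k%:R * h <= k.+1%:R * h by rewrite ler_wpM2r// ler_nat.
have eb : e n <= b.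
  have -> : b = expR (A n - A 0%N) * (e 0%N + (S n - S 0%N)).
    rewrite /b /e /A U0 W0 scaler0 addr0 normr0 add0r mul0r; congr (expR _ * _).
    by field; rewrite gt_eqF.
  apply: gronwall_discrete => k kn.
  - rewrite /A lerD// ?ler_wpM2l//.
    by rewrite ler_wpM2r ?invr_ge0 ?(ltW c0_gt0)//; apply: nu_mono.
  - by rewrite -subr_ge0; apply: le_trans (step k kn); exact: normr_ge0.
  have e0 : 0 <= e k by exact: normr_ge0.
  set l := lam (k%:R * h); set l' := lam (k.+1%:R * h).
  have q1 : `|l *: U k.+1 + W k.+1| <= (1 + K * h) * e k + (S k.+1 - S k).
    have -> : l *: U k.+1 + W k.+1 = (l *: U k + W k) +
       (l *: (U k.+1 - U k) + (W k.+1 - W k) + h *: D k) - h *: D k.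
      by apply: (dot_ext dot_norm) => z; rewrite !dotE; ring.
    have := step k kn; have := DK k kn => Dk st.
    apply: le_trans (ler_normB _ _) _.
    have := ler_normD (l *: U k + W k)
      (l *: (U k.+1 - U k) + (W k.+1 - W k) + h *: D k).
    have : `|h *: D k| <= K * h * e k.
      by rewrite normrZ (ger0_norm h0) [K * h]mulrC -mulrA ler_wpM2l.
    by rewrite -/l in st *; rewrite /e -/l; lra.
  pose q := (1 + K * h) * e k + (S k.+1 - S k); rewrite -/q in q1.
  have q0 : 0 <= q by exact: le_trans q1.
  have Uq : c0 * `|U k.+1| <= q.
    have [h1 _] := monotone_norm_le (lam_ge0 (k%:R * h)) (UW _ kn).
    by apply: le_trans q1; apply: le_trans h1; rewrite ler_wpM2r.
  (* replacing [l] by [l'] costs [|l' - l| |U k.+1|] *)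
  have le1 : e k.+1 <= q * (1 + (nu (k.+1%:R * h) - nu (k%:R * h)) / c0).
    have -> : e k.+1 = `|(l *: U k.+1 + W k.+1) + (l' - l) *: U k.+1|.
      rewrite /e -/l'; congr (`|_|).
      by apply: (dot_ext dot_norm) => z; rewrite !dotE; ring.
    apply: le_trans (ler_normD _ _) _; rewrite mulrDr mulr1 lerD//.
    rewrite normrZ; apply: (@le_trans _ _ ((nu (k.+1%:R * h) - nu (k%:R * h)) * (q / c0))).
      apply: ler_pM => //; first exact: lam_nu.
      by rewrite ler_pdivlMr// mulrC.
    by rewrite mulrCA.
  have nuk := nu_mono (kh k).
  have -> : expR (A k.+1 - A k) =
      expR (K * h) * expR ((nu (k.+1%:R * h) - nu (k%:R * h)) / c0).
    rewrite -expRD; congr expR; rewrite /A -natr1; field; rewrite gt_eqF//.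
  apply: le_trans le1 _; rewrite [leRHS]mulrAC; apply: ler_pM => //.
  - by rewrite addr_ge0// divr_ge0 ?subr_ge0// ltW.
  - have S0 : 0 <= S k.+1 - S k by apply: le_trans (step k kn).
    have E1 : 1 + K * h <= expR (K * h) by exact: expR_ge1Dx.
    have Kh0 : 0 <= K * h by rewrite mulr_ge0.
    rewrite /q mulrDr lerD//; first by rewrite ler_wpM2r.
    by rewrite -[leLHS]mul1r ler_wpM2r//; lra.
  exact: expR_ge1Dx.
have [h1 h2] := monotone_norm_le (lam_ge0 (n%:R * h)) (UW _ (leqnn n)).
split; last exact: le_trans h2 eb.
rewrite ler_pdivlMr// mulrC; apply: le_trans eb; apply: le_trans h1.
by rewrite ler_wpM2r.
Qed.

End DiscreteScheme.

(** * The implicit scheme and its a priori bounds *)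

Section ImplicitScheme.
Variables (R : realType) (H : completeNormedModType R).
Variable dot : {dot H for idfun}.
Hypothesis dot_norm : forall x : H, dot x x = `|x| ^+ 2.
Variable phi : H -> \bar R.
Hypothesis phi_proper : proper_function phi.
Variables (psi : H -> R) (g : H -> H).
Variables (lam : R -> R) (c0 : R).
Hypothesis c0_gt0 : 0 < c0.
Hypothesis lam_ge : forall t, c0 <= lam t.

Let lam_gt0 t : 0 < lam t := lt_le_trans c0_gt0 (lam_ge t).
Let lam_ge0 t : 0 <= lam t := ltW (lam_gt0 t).

(** Time discretisation of the Cauchy problem with step [h]: implicit in the
    maximal monotone part, explicit in the lower order terms. *)
Definition scheme (h : R) (X V : nat -> H) := forall k,
  subdifferential dot phi (X k) (V k) /\
  lam (k%:R * h) *: (X k.+1 - X k) + (V k.+1 - V k) + h *: (V k + g (X k)) = 0.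

(** Each step is one evaluation of a resolvent. *)
Lemma scheme_exists (h : R) (x0 v0 : H) :
  econvex_function phi -> lower_semicontinuous phi ->
  subdifferential dot phi x0 v0 ->
  exists X V, [/\ scheme h X V, X 0%N = x0 & V 0%N = v0].
Proof.
move=> phi_convex phi_lsc xv0.
have [p0 xp0] := subdifferential_fin phi_proper xv0.
have phi_lb y : ((p0 - `|v0| * `|x0| - `|v0| * `|y|)%:E <= phi y)%E.
  apply: le_trans (xv0 y); rewrite xp0 -EFinD lee_fin dotDr dotNr.
  have := dot_cauchy dot_norm v0 y; have := dot_le dot_norm v0 x0.
  by rewrite ler_norml => h1 /andP[h2 _]; lra.
have [res resP] : exists res : R -> H -> H, forall c z, 0 < c ->
    subdifferential dot phi (res c z) (z - c *: res c z).
  exists (fun c z => xget 0 [set x | subdifferential dot phi x (z - c *: x)]).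
  move=> c z c_gt0; case: xgetP => [x _ //|no].
  have [x xP] := resolvent_exists dot_norm phi_proper phi_convex phi_lsc phi_lb z c_gt0.
  by have := no x.
pose step k (p : H * H) := let l := lam (k%:R * h) in
  let z := l *: p.1 + p.2 - h *: (p.2 + g p.1) in (res l z, z - l *: res l z).
pose P := fix P k := if k is j.+1 then step j (P j) else (x0, v0).
exists (fun k => (P k).1), (fun k => (P k).2); split => // k; split.
  by case: k => [//|k]; exact: resP.
rewrite /= /step /=; set l := lam _; set x' := res _ _.
by apply: (dot_ext dot_norm) => z; rewrite dot0l !dotE; ring.
Qed.

(** Monotonicity of the increments gives speed bounds in terms of the lower
    order term alone. *)
Lemma scheme_increment (h : R) X V k : 0 <= h -> scheme h X V ->
  c0 * `|X k.+1 - X k| <= h * `|V k + g (X k)| /\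
  `|V k.+1 - V k| <= h * `|V k + g (X k)|.
Proof.
move=> h0 sch; have [xv eq] := sch k; have [xv' _] := sch k.+1.
have mono := subdifferential_monotone phi_proper xv' xv.
have [h1 h2] := monotone_norm_le dot_norm (lam_ge0 (k%:R * h)) mono.
have E : `|lam (k%:R * h) *: (X k.+1 - X k) + (V k.+1 - V k)| =
    h * `|V k + g (X k)|.
  rewrite -[in RHS](ger0_norm h0) -normrZ; apply/eqP.
  by move/eqP: eq; rewrite addr_eq0 => /eqP ->; rewrite normrN.
rewrite -E; split => //; apply: le_trans h1; exact: ler_wpM2r.
Qed.

Hypothesis psi_g : forall x y, psi x + dot (g x) (y - x) <= psi y.
Hypothesis g_lip : forall M, exists2 L : R, 0 <= L & forall x y,
  `|x| <= M -> `|y| <= M -> `|g x - g y| <= L * `|x - y|.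
Hypothesis phi_psi_lb : exists m : R, forall x : H, (m%:E <= phi x + (psi x)%:E)%E.

(** Test the scheme with the increment of [X]. The subgradient [V k.+1] at the
    new point controls the change of [phi]; it replaces the explicit [V k] at no
    cost because [h <= 1] and the increments pair nonnegatively. Evaluating [g]
    at the old point costs [h L |dX|^2], which half of the dissipation
    absorbs. *)
Lemma scheme_energy (h L p p' : R) X V k : 0 <= h <= 1 -> h * L <= c0 / 2 ->
  scheme h X V -> `|g (X k.+1) - g (X k)| <= L * `|X k.+1 - X k| ->
  phi (X k) = p%:E -> phi (X k.+1) = p'%:E ->
  c0 / 2 * `|X k.+1 - X k| ^+ 2 <= h * (p + psi (X k) - (p' + psi (X k.+1))).
Proof.
move=> /andP[h0 h1] hL sch gL xp xp'.
have [xv eq] := sch k; have [xv' _] := sch k.+1.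
have mono := subdifferential_monotone phi_proper xv' xv.
have sub := xv' (X k); rewrite xp xp' -EFinD lee_fin in sub.
have ps := psi_g (X k.+1) (X k).
have := congr1 (fun u => dot u (X k.+1 - X k)) eq.
rewrite dot0l.
have gd := dot_le dot_norm (g (X k.+1) - g (X k)) (X k.+1 - X k).
have gd' : `|g (X k.+1) - g (X k)| * `|X k.+1 - X k| <= L * `|X k.+1 - X k| ^+ 2.
  by rewrite expr2 mulrA ler_wpM2r.
have opp : X k - X k.+1 = - (X k.+1 - X k) by rewrite opprB.
rewrite opp !dotNr in sub ps.
rewrite -!dot_norm in gd' *.
move: (X k.+1 - X k) (lam_ge (k%:R * h)) => d lamc in mono sub ps gd gd' *.
have dd := dot_ge0 dot_norm d.
rewrite [dot d _](dotC dot) in mono.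
rewrite !dotE in mono gd; rewrite !dotE => eq'.
have m1 : 0 <= (1 - h) * (dot (V k.+1) d - dot (V k) d) by rewrite mulr_ge0//; lra.
have m2 : 0 <= h * (p - p' + dot (V k.+1) d) by rewrite mulr_ge0//; lra.
have m3 : 0 <= h * (psi (X k) - psi (X k.+1) + dot (g (X k.+1)) d).
  by rewrite mulr_ge0//; lra.
have m4 : 0 <= h * (L * dot d d - (dot (g (X k.+1)) d - dot (g (X k)) d)).
  by rewrite mulr_ge0//; lra.
have m5 : 0 <= (c0 / 2 - h * L) * dot d d by rewrite mulr_ge0//; lra.
have m6 : 0 <= (lam (k%:R * h) - c0) * dot d d by rewrite mulr_ge0//; lra.
lra.
Qed.

(** The energy bounds the squared increments, hence keeps [X] in a fixed ball
    up to time [T]; in a slightly larger ball [g] is Lipschitz, which justifies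
    the energy estimate for the next step provided [h] is small. *)
Lemma scheme_bounded (T : R) (x0 v0 : H) : 0 < T ->
  subdifferential dot phi x0 v0 ->
  exists2 h0 : R, 0 < h0 & exists M : R, forall h X V, 0 < h <= h0 ->
    scheme h X V -> X 0%N = x0 -> V 0%N = v0 ->
    forall k, k%:R * h <= T -> `|X k| <= M /\ `|V k| <= M.
Proof.
move=> T0 xv0; have [m mlb] := phi_psi_lb.
have [p0 xp0] := subdifferential_fin phi_proper xv0.
pose E0 := p0 + psi x0 - m.
have E00 : 0 <= E0.
  by have := mlb x0; rewrite xp0 -EFinD lee_fin /E0; lra.
(* [Q] bounds [|X k - x0|^2] and [Mv] bounds [|V k|] *)
pose Q := 2 / c0 * (T * E0).
have Q0 : 0 <= Q by rewrite !mulr_ge0// ?invr_ge0 ltW.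
pose r := `|x0| + 1 + Q.
have r0 : 0 <= r by rewrite !addr_ge0.
have [L L0 gL] := g_lip (r + 1).
pose G := `|g 0| + L * (r + 1).
have G0 : 0 <= G by rewrite addr_ge0// mulr_ge0//; lra.
have gG x : `|x| <= r -> `|g x| <= G.
  move=> xr; have := gL x 0; rewrite normr0 subr0.
  move=> /(_ _ _)h; have {}h : `|g x - g 0| <= L * `|x| by apply: h; lra.
  have : L * `|x| <= L * (r + 1) by rewrite ler_wpM2l//; lra.
  have := ler_normD (g x - g 0) (g 0); rewrite subrK /G; lra.
pose Mv := expR T * (`|v0| + G * T).
have GT0 : 0 <= G * T by rewrite mulr_ge0// ltW.
have Mv0 : 0 <= Mv by rewrite mulr_ge0 ?expR_ge0// addr_ge0.
pose h0 := Num.min 1 (Num.min (c0 / 2 / (L + 1)) (c0 / (Mv + G + 1))).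
have L1 : 0 < L + 1 by lra.
have MG1 : 0 < Mv + G + 1 by lra.
exists h0; first by rewrite !lt_min ltr01 !divr_gt0.
exists (r + Mv) => h X V /andP[h_gt0]; rewrite !le_min => /and3P[h1 hL hMG].
rewrite ler_pdivlMr// in hL; rewrite ler_pdivlMr// in hMG.
have hL' : h * L <= c0 / 2 by lra.
have hMG' : h * (Mv + G) <= c0 by lra.
move=> sch X0 V0.
have bX k p S : k%:R * h <= T -> phi (X k) = p%:E ->
    `|X k - x0| ^+ 2 <= k%:R * S -> 0 <= S ->
    c0 / 2 * S <= h * (p0 + psi x0 - (p + psi (X k))) -> `|X k| <= r.
  move=> khT xp XS S0 Sle.
  have e1 : p0 + psi x0 - (p + psi (X k)) <= E0.
    by have := mlb (X k); rewrite xp -EFinD lee_fin /E0; lra.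
  have : k%:R * S <= Q.
    rewrite -(ler_pM2l (_ : 0 < c0 / 2)) ?divr_gt0//.
    have -> : c0 / 2 * Q = T * E0 by rewrite /Q; field; rewrite gt_eqF.
    rewrite mulrCA; apply: (@le_trans _ _ (k%:R * h * E0)).
      by rewrite -mulrA ler_wpM2l//; apply: le_trans Sle _; rewrite ler_pM2l.
    by rewrite ler_wpM2r.
  move=> kS; have : `|X k - x0| ^+ 2 <= Q by exact: le_trans kS.
  have : 0 <= (`|X k - x0| - 1) ^+ 2 by exact: sqr_ge0.
  have := ler_normD (X k - x0) x0; rewrite subrK /r.
  have := normr_ge0 (X k - x0); move: `|X k - x0| => t t0.
  rewrite !expr2 => ? ? ?.
  have [t1|t1] := leP t 1; first by lra.
  have : 0 <= (t - 1) * t by rewrite mulr_ge0; lra.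
  lra.
(* [S] stands for the sum of the squared increments up to [k] *)
have inv k : k%:R * h <= T -> [/\ exists p, phi (X k) = p%:E /\
    exists S, [/\ 0 <= S, `|X k - x0| ^+ 2 <= k%:R * S &
      c0 / 2 * S <= h * (p0 + psi x0 - (p + psi (X k)))] &
    `|V k| <= expR (k%:R * h) * (`|v0| + G * (k%:R * h))].
  elim: k => [_|k IH khT].
    split; last by rewrite V0 mul0r expR0 mulr0 addr0 mul1r.
    exists p0; rewrite X0; split => //; exists 0.
    by rewrite !subrr normr0 expr0n/= !mulr0.
  have khT' : k%:R * h <= T.
    by apply: le_trans khT; rewrite ler_wpM2r ?ler_nat// ltW.
  have [[p [xp [S [S0 XS Sle]]]] Vk] := IH khT'.
  have Xr := bX _ _ _ khT' xp XS S0 Sle.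
  have kh0 : 0 <= k%:R * h by rewrite mulr_ge0// ltW.
  have VMv : `|V k| <= Mv.
    apply: le_trans Vk _; apply: ler_pM; rewrite ?expR_ge0 ?ler_expR//.
      by rewrite addr_ge0// mulr_ge0.
    by rewrite lerD2l ler_wpM2l.
  have [dX dV] := scheme_increment k (ltW h_gt0) sch.
  have gk := gG _ Xr; have VG := ler_normD (V k) (g (X k)).
  have dX1 : `|X k.+1 - X k| <= 1.
    rewrite -(ler_pM2l c0_gt0) mulr1; apply: le_trans dX _.
    by apply: le_trans hMG'; rewrite ler_pM2l//; lra.
  have Xr1 : `|X k.+1| <= r + 1.
    by have := ler_normD (X k.+1 - X k) (X k); rewrite subrK; lra.
  have [xv' _] := sch k.+1.
  have [p' xp'] := subdifferential_fin phi_proper xv'.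
  have h01 : 0 <= h <= 1 by rewrite ltW.
  have en := scheme_energy h01 hL' sch (gL _ _ Xr1 _) xp xp'.
  have {}en := en (le_trans Xr _); rewrite lerDl in en; have {}en := en ler01.
  split.
    exists p'; split => //; exists (S + `|X k.+1 - X k| ^+ 2); split.
    - by rewrite addr_ge0// sqr_ge0.
    - have tri := ler_normD (X k.+1 - X k) (X k - x0).
      rewrite addrA subrK in tri.
      have d0 := normr_ge0 (X k.+1 - X k); have a0 := normr_ge0 (X k - x0).
      move: (normr_ge0 (X k.+1 - x0)) tri XS.
      move: `|X k.+1 - x0| `|X k.+1 - X k| `|X k - x0| d0 a0 => b d a d0 a0 b0 tri XS.
      have k0 : (0 : R) <= k%:R by [].
      (* inequality of the means for [S] and [k d^2], as [a^2 <= k S] *)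
      have ad : 2 * (a * d) <= S + k%:R * d ^+ 2.
        rewrite -(ler_pXn2r (_ : (0 < 2)%N)) ?nnegrE//; last 2 first.
        - by rewrite !mulr_ge0.
        - by rewrite addr_ge0// mulr_ge0// sqr_ge0.
        have h1' : 0 <= (S - k%:R * d ^+ 2) ^+ 2 by exact: sqr_ge0.
        have h2' : a ^+ 2 * d ^+ 2 <= k%:R * S * d ^+ 2.
          by rewrite ler_wpM2r// sqr_ge0.
        lra.
      apply: (@le_trans _ _ ((d + a) ^+ 2)); first by rewrite ler_pXn2r ?nnegrE//; lra.
      rewrite -natr1; lra.
    lra.
  have E1 : 1 + h <= expR h by exact: expR_ge1Dx.
  have -> : k.+1%:R * h = h + k%:R * h by rewrite -natr1; ring.
  rewrite expRD.
  have Ek1 : 1 <= expR (k%:R * h) by apply: le_trans (expR_ge1Dx _); rewrite lerDl.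
  set E := expR (k%:R * h) in Vk Ek1 *.
  set B := `|v0| + G * (k%:R * h) in Vk *.
  have B0 : 0 <= B by rewrite addr_ge0// mulr_ge0.
  have -> : `|v0| + G * (h + k%:R * h) = B + h * G by rewrite /B; ring.
  have hG0 : 0 <= h * G by rewrite mulr_ge0// ltW.
  apply: (@le_trans _ _ ((1 + h) * (E * B) + h * G)).
    have := ler_normD (V k.+1 - V k) (V k); rewrite subrK => tri.
    have : h * `|V k + g (X k)| <= h * (`|V k| + G) by rewrite ler_pM2l//; lra.
    have : h * `|V k| <= h * (E * B) by rewrite ler_pM2l.
    lra.
  have EB0 : 0 <= E * B by rewrite mulr_ge0//; lra.
  have m1 : (1 + h) * (E * B) <= expR h * (E * B) by rewrite ler_wpM2r.
  have m2 : 1 * (h * G) <= expR h * E * (h * G).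
    rewrite ler_wpM2r// -[leLHS]mulr1 ler_pM//; lra.
  lra.
move=> k khT; have [[p [xp [S [S0 XS Sle]]]] Vk] := inv k khT.
have Xr := bX _ _ _ khT xp XS S0 Sle; split; first lra.
have kh0 : 0 <= k%:R * h by rewrite mulr_ge0// ltW.
apply: le_trans Vk _; apply: (@le_trans _ _ Mv); last by lra.
apply: ler_pM; rewrite ?expR_ge0 ?ler_expR//.
  by rewrite addr_ge0// mulr_ge0.
by rewrite lerD2l ler_wpM2l.
Qed.

End ImplicitScheme.

(** * Consistency and refinement of the scheme *)

Section Convergence.
Variables (R : realType) (H : completeNormedModType R).
Variable dot : {dot H for idfun}.
Hypothesis dot_norm : forall x : H, dot x x = `|x| ^+ 2.
Variable phi : H -> \bar R.
Hypothesis phi_proper : proper_function phi.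
Variable g : H -> H.
Hypothesis g_lip : forall M, exists2 L : R, 0 <= L & forall x y,
  `|x| <= M -> `|y| <= M -> `|g x - g y| <= L * `|x - y|.
Variables (lam nu : R -> R) (c0 : R).
Hypothesis c0_gt0 : 0 < c0.
Hypothesis lam_ge : forall t, c0 <= lam t.
Hypothesis nu_mono : forall s t, s <= t -> nu s <= nu t.
Hypothesis lam_nu : forall s t, s <= t -> `|lam t - lam s| <= nu t - nu s.

Local Notation scheme := (scheme dot phi g lam).
Let lam_gt0 t : 0 < lam t := lt_le_trans c0_gt0 (lam_ge t).
Let lam_ge0 t : 0 <= lam t := ltW (lam_gt0 t).

(** A residual proportional to the variation of [lam] over the step, which need
    not be small, sums up to [O(h)] because it carries a factor [h] and the
    variations telescope. Both the scheme with a halved step and the exact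
    solutions have such a residual. *)
Lemma scheme_consistency (T M a b : R) : 0 <= T -> 0 <= a -> 0 <= b ->
  exists2 C : R, 0 <= C & forall h X V Y Z, 0 < h -> scheme h X V ->
  Y 0%N = X 0%N -> Z 0%N = V 0%N ->
  (forall k, k%:R * h <= T ->
     [/\ `|X k| <= M, `|Y k| <= M & subdifferential dot phi (Y k) (Z k)]) ->
  (forall k, k.+1%:R * h <= T ->
     `|lam (k%:R * h) *: (Y k.+1 - Y k) + (Z k.+1 - Z k) + h *: (Z k + g (Y k))|
     <= h * (a * (nu (k.+1%:R * h) - nu (k%:R * h)) + b * h)) ->
  forall k, k%:R * h <= T -> `|X k - Y k| <= C * h /\ `|V k - Z k| <= C * h.
Proof.
move=> T0 a0 b0; have [L L0 gL] := g_lip M.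
pose K := 1 + L / c0.
have Lc0 : 0 <= L / c0 by rewrite divr_ge0// ltW.
have K0 : 0 <= K by rewrite /K; lra.
have nuT := nu_mono T0.
pose E := expR (K * T + (nu T - nu 0) / c0).
pose C1 := E * (a * (nu T - nu 0) + b * T).
have C10 : 0 <= C1.
  by rewrite mulr_ge0 ?expR_ge0// addr_ge0// mulr_ge0// subr_ge0.
have C1c : 0 <= C1 / c0 by rewrite divr_ge0// ltW.
exists (C1 / c0 + C1); first by lra.
move=> h X V Y Z h0 sch Y0 Z0 bnd res n nT.
have kT k : (k <= n)%N -> k%:R * h <= T.
  by move=> kn; apply: le_trans nT; rewrite ler_wpM2r ?ler_nat// ltW.
pose U k := X k - Y k; pose W k := V k - Z k.
pose D k := (V k + g (X k)) - (Z k + g (Y k)).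
pose S k := h * (a * nu (k%:R * h) + b * (k%:R * h)).
have UW k : (k <= n)%N -> 0 <= dot (U k) (W k).
  move=> /kT/bnd[_ _ yz]; have [xv _] := sch k.
  exact: (subdifferential_monotone phi_proper xv yz).
have := @scheme_stability R H dot dot_norm lam nu c0 c0_gt0 lam_ge nu_mono lam_nu
  h K U W D S n (ltW h0) K0.
rewrite /U /W Y0 Z0 !subrr => /(_ erefl erefl UW) stab.
have [||U1 W1] := stab.
- move=> k kn; have [Xk Yk _] := bnd _ (kT _ (ltnW kn)).
  have [h1 h2] := monotone_norm_le dot_norm (lam_ge0 (k%:R * h)) (UW _ (ltnW kn)).
  set q := `|_ + _| in h1 h2 *.
  have -> : D k = W k + (g (X k) - g (Y k)).
    by apply: (dot_ext dot_norm) => z; rewrite !dotE; ring.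
  apply: le_trans (ler_normD _ _) _; rewrite /K mulrDl mul1r lerD//.
  apply: le_trans (gL _ _ Xk Yk) _; rewrite -mulrA ler_wpM2l//.
  rewrite ler_pdivlMl//; apply: le_trans h1; rewrite ler_wpM2r//.
- move=> k kn; have [_ eq] := sch k.
  have -> : S k.+1 - S k = h * (a * (nu (k.+1%:R * h) - nu (k%:R * h)) + b * h).
    by rewrite /S -natr1; ring.
  apply: le_trans (res k (kT _ kn)); rewrite -normrN.
  rewrite le_eqVlt; apply/orP; left; apply/eqP; congr (`|_|).
  rewrite -[RHS]subr0 -eq.
  by apply: (dot_ext dot_norm) => z; rewrite !dotE; ring.
set b1 := expR _ * _ in U1 W1.
have nun := nu_mono nT.
have nu0n : nu 0 <= nu (n%:R * h) by apply: nu_mono; rewrite mulr_ge0// ltW.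
have nh0 : 0 <= n%:R * h by rewrite mulr_ge0// ltW.
have b1C : b1 <= C1 * h.
  rewrite /b1 /C1 -mulrA; apply: ler_pM.
  - exact: expR_ge0.
  - have -> : S n - S 0%N = h * (a * (nu (n%:R * h) - nu 0) + b * (n%:R * h)).
      by rewrite /S mul0r; ring.
    by rewrite mulr_ge0 ?(ltW h0)// addr_ge0// mulr_ge0// subr_ge0.
  - rewrite ler_expR lerD//; first by rewrite ler_wpM2l.
    by rewrite ler_wpM2r ?invr_ge0 ?(ltW c0_gt0)// lerB.
  rewrite /S mul0r mulr0 addr0 -mulrBr mulrC ler_wpM2r ?(ltW h0)//.
  have h1 : b * (n%:R * h) <= b * T by rewrite ler_wpM2l.
  have h2 : a * (nu (n%:R * h) - nu 0) <= a * (nu T - nu 0).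
    by rewrite ler_wpM2l// lerB.
  lra.
have b1c : b1 / c0 <= C1 / c0 * h.
  by rewrite [leRHS]mulrAC ler_wpM2r// invr_ge0 ltW.
have C1h : 0 <= C1 * h by rewrite mulr_ge0// ltW.
have C1ch : 0 <= C1 / c0 * h by rewrite mulr_ge0// ltW.
by split; lra.
Qed.

(** Two fine steps differ from a coarse one by freezing [lam] and the lower
    order term at the left end point. *)
Lemma scheme_refine (T M : R) : 0 <= T ->
  exists2 C : R, 0 <= C & forall h X V X' V', 0 < h -> scheme h X V ->
  scheme (h / 2) X' V' -> X' 0%N = X 0%N -> V' 0%N = V 0%N ->
  (forall k, k%:R * h <= T -> `|X k| <= M) ->
  (forall k, k%:R * (h / 2) <= T -> `|X' k| <= M /\ `|V' k| <= M) ->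
  forall k, k%:R * h <= T ->
    `|X k - X' k.*2| <= C * h /\ `|V k - V' k.*2| <= C * h.
Proof.
move=> T0; have [L L0 gL] := g_lip M.
have [M0|M0] := ltP M 0.
  exists 0 => // h X V X' V' h0 _ _ _ _ XM _ k kT.
  by have := XM _ kT; have := normr_ge0 (X k); lra.
pose B := M + (`|g 0| + L * M).
have B0 : 0 <= B by rewrite !addr_ge0// mulr_ge0.
pose K := 1 + L / c0.
have Lc0 : 0 <= L / c0 by rewrite divr_ge0// ltW.
have K0 : 0 <= K by rewrite /K; lra.
have Bc0 : 0 <= B / c0 by rewrite divr_ge0// ltW.
have BK0 : 0 <= B * K by rewrite mulr_ge0.
have [C C0 cons] := @scheme_consistency T M (B / c0) (B * K) T0 Bc0 BK0.
exists C => // h X V X' V' h0 sch sch' X0 V0 XM XM' k kT.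
have h20 : 0 < h / 2 by rewrite divr_gt0.
have node j : j.*2%:R * (h / 2) = j%:R * h.
  by rewrite -muln2 natrM; field.
apply: (cons h X V (fun j => X' j.*2) (fun j => V' j.*2)) => // {k kT}[k kT|k kT].
  have kT' : k.*2%:R * (h / 2) <= T by rewrite node.
  by have [x'M _] := XM' _ kT'; split => //; [exact: XM|have [] := sch' k.*2].
have [_ e1] := sch' k.*2; have [_ e2] := sch' k.*2.+1.
have k2T : k.*2.+2%:R * (h / 2) <= T by rewrite -doubleS node.
have k1T : k.*2.+1%:R * (h / 2) <= T.
  by apply: le_trans k2T; rewrite ler_wpM2r ?ler_nat// ltW.
have k0T : k.*2%:R * (h / 2) <= T.
  by apply: le_trans k1T; rewrite ler_wpM2r ?ler_nat// ltW.
have FB j : j%:R * (h / 2) <= T -> `|V' j + g (X' j)| <= B.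
  move=> /XM'[xM vM]; have h1 := gL (X' j) 0 xM.
  rewrite normr0 subr0 in h1; have {}h1 := h1 M0.
  have h2 : L * `|X' j| <= L * M by rewrite ler_wpM2l.
  have := ler_normD (g (X' j) - g 0) (g 0); rewrite subrK.
  by have := ler_normD (V' j) (g (X' j)); rewrite /B; lra.
have [dX1 dV1] := scheme_increment dot_norm phi_proper c0_gt0 lam_ge k.*2 (ltW h20) sch'.
have [dX2 dV2] := scheme_increment dot_norm phi_proper c0_gt0 lam_ge k.*2.+1 (ltW h20) sch'.
have F1 : h / 2 * `|V' k.*2 + g (X' k.*2)| <= h / 2 * B by rewrite ler_pM2l// FB.
have F2 : h / 2 * `|V' k.*2.+1 + g (X' k.*2.+1)| <= h / 2 * B.
  by rewrite ler_pM2l// FB.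
have [XM0 _] := XM' _ k0T; have [XM1 _] := XM' _ k1T.
have dF : `|(V' k.*2 + g (X' k.*2)) - (V' k.*2.+1 + g (X' k.*2.+1))| <= h / 2 * (B * K).
  have -> : (V' k.*2 + g (X' k.*2)) - (V' k.*2.+1 + g (X' k.*2.+1)) =
     - (V' k.*2.+1 - V' k.*2) - (g (X' k.*2.+1) - g (X' k.*2)).
    by apply: (dot_ext dot_norm) => z; rewrite !dotE; ring.
  have := ler_normB (- (V' k.*2.+1 - V' k.*2)) (g (X' k.*2.+1) - g (X' k.*2)).
  rewrite normrN; have := gL _ _ XM1 XM0.
  have : L * `|X' k.*2.+1 - X' k.*2| <= L / c0 * (h / 2 * B).
    by rewrite -mulrA ler_wpM2l// ler_pdivlMl//; lra.
  rewrite /K; lra.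
have lnode : k.*2%:R * (h / 2) <= k.*2.+1%:R * (h / 2).
  by rewrite ler_wpM2r ?ler_nat// ltW.
have dlam := lam_nu lnode.
have nu2 : nu (k.*2.+1%:R * (h / 2)) <= nu (k.+1%:R * h).
  by apply: nu_mono; rewrite -node doubleS ler_wpM2r ?ler_nat// ltW.
have dX2' : `|X' k.*2.+2 - X' k.*2.+1| <= h / 2 * (B / c0).
  by rewrite mulrA ler_pdivlMr// mulrC; lra.
rewrite !node in dlam.
have -> : lam (k%:R * h) *: (X' k.+1.*2 - X' k.*2) + (V' k.+1.*2 - V' k.*2) +
   h *: (V' k.*2 + g (X' k.*2)) =
   - (lam (k.*2.+1%:R * (h / 2)) - lam (k%:R * h)) *: (X' k.*2.+2 - X' k.*2.+1)
   + (h / 2) *: ((V' k.*2 + g (X' k.*2)) - (V' k.*2.+1 + g (X' k.*2.+1))).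
  rewrite -[LHS]subr0 -[in LHS](addr0 (0 : H)) -{1}e1 -e2 node doubleS.
  by apply: (dot_ext dot_norm) => z; rewrite !dotE; field.
apply: le_trans (ler_normD _ _) _.
rewrite (normrZ (- _)) (normrZ (h / 2)) normrN (gtr0_norm h20).
have m1 : `|lam (k.*2.+1%:R * (h / 2)) - lam (k%:R * h)| *
    `|X' k.*2.+2 - X' k.*2.+1| <=
    (nu (k.+1%:R * h) - nu (k%:R * h)) * (h / 2 * (B / c0)).
  by apply: ler_pM => //; lra.
have m2 : h / 2 * `|(V' k.*2 + g (X' k.*2)) - (V' k.*2.+1 + g (X' k.*2.+1))| <=
    h / 2 * (h / 2 * (B * K)) by rewrite ler_pM2l.
have m3 : 0 <= h * (h * (B * K)) by rewrite !mulr_ge0// ltW.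
have m4 : 0 <= (nu (k.+1%:R * h) - nu (k%:R * h)) * (h * (B / c0)).
  have : nu (k%:R * h) <= nu (k.*2.+1%:R * (h / 2)) by apply: nu_mono; rewrite -node.
  by move=> ?; apply: mulr_ge0; [lra|apply: mulr_ge0 => //; exact: ltW].
lra.
Qed.

End Convergence.

(** * The limit of the scheme *)

Section Limit.
Variables (R : realType) (H : completeNormedModType R).
Variable dot : {dot H for idfun}.
Hypothesis dot_norm : forall x : H, dot x x = `|x| ^+ 2.
Variable phi : H -> \bar R.
Hypothesis phi_proper : proper_function phi.
Hypothesis phi_lsc : lower_semicontinuous phi.
Variable g : H -> H.
Hypothesis g_lip : forall M, exists2 L : R, 0 <= L & forall x y,
  `|x| <= M -> `|y| <= M -> `|g x - g y| <= L * `|x - y|.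
Variables (lam nu : R -> R) (c0 : R).
Hypothesis c0_gt0 : 0 < c0.
Hypothesis lam_ge : forall t, c0 <= lam t.
Hypothesis nu_mono : forall s t, s <= t -> nu s <= nu t.
Hypothesis lam_nu : forall s t, s <= t -> `|lam t - lam s| <= nu t - nu s.
Variables (T M L : R).
Hypothesis L_ge0 : 0 <= L.
Hypothesis gL : forall x y, `|x| <= M -> `|y| <= M -> `|g x - g y| <= L * `|x - y|.
Variable B : R.
Hypothesis B_ge0 : 0 <= B.
Hypothesis lower_order_bound : forall u w,
  `|u| <= M -> `|w| <= M -> `|w + g u| <= B.
Variables (x0 v0 : H) (hh : nat -> R) (X V : nat -> nat -> H).
Hypothesis T_ge0 : 0 <= T.
Hypothesis hh_gt0 : forall n, 0 < hh n.
Hypothesis hhS : forall n, hh n.+1 = hh n / 2.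
Hypothesis XV_scheme : forall n, scheme dot phi g lam (hh n) (X n) (V n).
Hypothesis X_init : forall n, X n 0%N = x0.
Hypothesis V_init : forall n, V n 0%N = v0.
Hypothesis XV_bounded : forall n k, k%:R * hh n <= T ->
  `|X n k| <= M /\ `|V n k| <= M.

Let lam_ge0 t : 0 <= lam t := le_trans (ltW c0_gt0) (lam_ge t).

Definition node n t := Num.truncn (t / hh n).

Lemma node_itv n t : 0 <= t ->
  (node n t)%:R * hh n <= t /\ t < (node n t)%:R * hh n + hh n.
Proof.
move=> t0; have /truncn_itv/andP[h1 h2] : 0 <= t / hh n.
  by rewrite divr_ge0// ltW.
split; first by rewrite -ler_pdivlMr.
by move: h2; rewrite ltr_pdivrMr// -natr1 mulrDl mul1r.
Qed.

Lemma node_nat n k : node n (k%:R * hh n) = k.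
Proof. by rewrite /node mulfK ?gt_eqF// natrK. Qed.

Lemma node_le n s t : s <= t -> (node n s <= node n t)%N.
Proof.
by move=> st; apply: le_truncn; rewrite ler_wpM2r// invr_ge0 ltW.
Qed.

Lemma node_double n t : 0 <= t ->
  node n.+1 t = (node n t).*2 \/ node n.+1 t = (node n t).*2.+1.
Proof.
move=> t0; have [h1 h2] := node_itv n t0; have [h3 h4] := node_itv n.+1 t0.
have hn := hh_gt0 n.
have l1 : ((node n t).*2 < (node n.+1 t).+1)%N.
  rewrite -(@ltr_nat R) -(ltr_pM2r (hh_gt0 n.+1)) -natr1 mulrDl mul1r.
  by apply: le_lt_trans h4; rewrite hhS -muln2 natrM; lra.
have l2 : (node n.+1 t < (node n t).*2.+2)%N.
  rewrite -(@ltr_nat R) -(ltr_pM2r (hh_gt0 n.+1)); apply: le_lt_trans h3 _.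
  by rewrite hhS -doubleS -muln2 natrM -natr1; lra.
move: l1 l2; rewrite !ltnS leq_eqVlt => /predU1P[->|l1 l2]; first by left.
by right; apply/eqP; rewrite eqn_leq l2.
Qed.

Lemma hh_cvg0 : hh @ \oo --> (0 : R).
Proof.
have hle n : hh n <= hh 0%N * n.+1%:R^-1.
  elim: n => [|n IH]; first by rewrite invr1 mulr1.
  rewrite hhS; apply: (@le_trans _ _ (hh 0%N * n.+1%:R^-1 / 2)).
    by rewrite ler_wpM2r.
  rewrite -mulrA ler_pM2l// -invfM lef_pV2 ?posrE ?mulr_gt0//.
  by rewrite -natrM ler_nat muln2 -addnn addSn addnS !ltnS leq_addr.
apply: (@squeeze_cvgr _ _ _ _ (fun=> 0) (fun n => hh 0%N * n.+1%:R^-1)).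
- by apply: nearW => n; rewrite hle ltW.
- exact: cvg_cst.
- rewrite -[X in _ --> X](mulr0 (hh 0%N)).
  by apply: cvgM; [exact: cvg_cst|exact: cvg_harmonic].
Qed.

Lemma hh_eventually (e : R) : 0 < e ->
  exists N, forall n, (N <= n)%N -> hh n < e.
Proof.
move=> e0; have /cvgrPdist_lt/(_ _ e0)[N _ h] := hh_cvg0.
by exists N => n /h /=; rewrite sub0r normrN (gtr0_norm (hh_gt0 n)).
Qed.

(** Only the small steps matter, which is what the threshold [d] expresses. *)
Lemma le_hh_limit (a b c d : R) : 0 < d ->
  (forall n, hh n < d -> a <= b + c * hh n) -> a <= b.
Proof.
move=> d0 abc; apply/ler_addgt0Pr => e e0.
have c1 : 0 < `|c| + 1 by rewrite ltr_wpDl.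
have m0 : 0 < Num.min d (e / (`|c| + 1)) by rewrite lt_min d0 divr_gt0.
have [N /(_ N (leqnn N))] := hh_eventually m0.
rewrite lt_min => /andP[hd he]; apply: le_trans (abc N hd) _; rewrite lerD2l.
rewrite ltr_pdivlMr// in he; apply: le_trans (ltW he); rewrite mulrC.
by rewrite ler_pM2l//; apply: le_trans (ler_norm _) _; rewrite lerDl.
Qed.

Lemma hh_close_cvg (u : nat -> H) l (c : R) :
  (forall n, `|l - u n| <= c * hh n) -> u @ \oo --> l.
Proof.
move=> close.
have ch : c * hh n @[n --> \oo] --> (0 : R).
  have := cvgM (cvg_cst c) hh_cvg0; rewrite mulr0; exact.
apply/cvgrPdist_le => e e0; have [N _ hN] := cvgr_le _ ch _ e0.
by exists N => // n Nn; apply: le_trans (close n) (hN n Nn).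
Qed.

Lemma XV_step n k : k%:R * hh n <= T ->
  c0 * `|X n k.+1 - X n k| <= hh n * B /\ `|V n k.+1 - V n k| <= hh n * B.
Proof.
move=> kT; have [xM vM] := XV_bounded kT.
have FB := lower_order_bound xM vM.
have [h1 h2] := scheme_increment dot_norm phi_proper c0_gt0 lam_ge k
  (ltW (hh_gt0 n)) (XV_scheme n).
have : hh n * `|V n k + g (X n k)| <= hh n * B by rewrite ler_pM2l.
by split; lra.
Qed.

Lemma XV_increment n i j : (i <= j)%N -> j%:R * hh n <= T ->
  c0 * `|X n j - X n i| <= (j%:R * hh n - i%:R * hh n) * B /\
  `|V n j - V n i| <= (j%:R * hh n - i%:R * hh n) * B.
Proof.
elim: j => [|j IH]; first by rewrite leqn0 => /eqP -> _; rewrite !subrr !normr0 mul0r mulr0.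
rewrite leq_eqVlt => /predU1P[-> _|ij jT].
  by rewrite !subrr !normr0 mul0r mulr0.
have jT' : j%:R * hh n <= T.
  by apply: le_trans jT; rewrite ler_wpM2r ?ler_nat// ltW.
have [IX IV] := IH ij jT'; have [sX sV] := XV_step jT'.
have tX := ler_normD (X n j.+1 - X n j) (X n j - X n i).
have tV := ler_normD (V n j.+1 - V n j) (V n j - V n i).
rewrite addrA subrK in tX; rewrite addrA subrK in tV.
rewrite -(ler_pM2l c0_gt0) in tX.
by rewrite -natr1; split; lra.
Qed.

(** Consecutive levels differ by [O(hh n)] at the node preceding [t], by
    [scheme_refine] and at most one fine step; as [hh] is geometric, the values
    form a Cauchy sequence. *)
Lemma scheme_limit : exists x v : R -> H, exists2 C : R, 0 <= C &
  forall n t, 0 <= t <= T -> `|x t - X n (node n t)| <= C * hh n /\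
    `|v t - V n (node n t)| <= C * hh n.
Proof.
have [C C0 ref] := @scheme_refine R H dot dot_norm phi phi_proper g g_lip lam nu
  c0 c0_gt0 lam_ge nu_mono lam_nu T M T_ge0.
have B0 := B_ge0; pose C1 := C + B + B / c0.
have Bc0 : 0 <= B / c0 by rewrite divr_ge0// ltW.
have C10 : 0 <= C1 by rewrite /C1; lra.
have consec n t : 0 <= t <= T ->
    `|X n.+1 (node n.+1 t) - X n (node n t)| <= C1 * hh n /\
    `|V n.+1 (node n.+1 t) - V n (node n t)| <= C1 * hh n.
  move=> /andP[t0 tT]; have [h1 h2] := node_itv n t0.
  have [h3 h4] := node_itv n.+1 t0.
  have hn := hh_gt0 n; have kT : (node n t)%:R * hh n <= T by lra.
  have [|||||r1 r2] := ref (hh n) (X n) (V n) (X n.+1) (V n.+1) (hh_gt0 n)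
    (XV_scheme n) _ _ _ _ _ _ kT.
  - by rewrite -hhS.
  - by rewrite !X_init.
  - by rewrite !V_init.
  - by move=> k /XV_bounded[].
  - by rewrite -hhS; exact: XV_bounded.
  have Bh : 0 <= B * hh n by rewrite mulr_ge0// ltW.
  have Bch : 0 <= B / c0 * hh n by rewrite mulr_ge0// ltW.
  have [->|Eq] := node_double n t0.
    by rewrite distrC [`|V _ _ - _|]distrC /C1; split; lra.
  have kE : (node n t).*2%:R * hh n.+1 = (node n t)%:R * hh n.
    by rewrite hhS -muln2 natrM; field.
  have [|s1 s2] := @XV_step n.+1 (node n t).*2; first by rewrite kE.
  rewrite -ler_pdivlMl// in s1; rewrite hhS in s1 s2.
  rewrite Eq; split.
    have := ler_normD (X n.+1 (node n t).*2.+1 - X n.+1 (node n t).*2)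
      (X n.+1 (node n t).*2 - X n (node n t)).
    by rewrite addrA subrK [`|X n.+1 _ - X n _|]distrC /C1; lra.
  have := ler_normD (V n.+1 (node n t).*2.+1 - V n.+1 (node n t).*2)
    (V n.+1 (node n t).*2 - V n (node n t)).
  by rewrite addrA subrK [`|V n.+1 _ - V n _|]distrC /C1; lra.
have tele (u : nat -> H) : (forall n, `|u n.+1 - u n| <= C1 * hh n) ->
    exists l, forall n, `|l - u n| <= 2 * C1 * hh n.
  move=> ucons; apply: cauchy_rate_lim.
    rewrite -[X in _ --> X](mulr0 (2 * C1)).
    by apply: cvgM; [exact: cvg_cst|exact: hh_cvg0].
  move=> n m nm; suff : `|u m - u n| <= 2 * C1 * (hh n - hh m).
    move=> h; apply: le_trans h _.
    rewrite ler_wpM2l ?mulr_ge0// lerBlDr lerDl; exact: ltW.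
  elim: m nm => [|m IH]; first by rewrite leqn0 => /eqP ->; rewrite !subrr normr0 mulr0.
  rewrite leq_eqVlt => /predU1P[->|/IH{}IH]; first by rewrite !subrr normr0 mulr0.
  have := ler_normD (u m.+1 - u m) (u m - u n); rewrite addrA subrK.
  by have := ucons m; rewrite hhS; lra.
have lim t : exists p : H * H, 0 <= t <= T -> forall n,
    `|p.1 - X n (node n t)| <= 2 * C1 * hh n /\
    `|p.2 - V n (node n t)| <= 2 * C1 * hh n.
  have [tT|] := boolP (0 <= t <= T); last by exists (0, 0).
  have [l hl] := tele _ (fun n => (consec n t tT).1).
  have [l' hl'] := tele _ (fun n => (consec n t tT).2).
  by exists (l, l') => _ n; split.
exists (fun t => (projT1 (cid (lim t))).1), (fun t => (projT1 (cid (lim t))).2).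
exists (2 * C1); first by rewrite mulr_ge0.
by move=> n t tT; case: cid => p /= /(_ tT n).
Qed.

Section LimitProperties.
Variables (x v : R -> H) (C : R).
Hypothesis C_ge0 : 0 <= C.
Hypothesis xv_limit : forall n t, 0 <= t <= T ->
  `|x t - X n (node n t)| <= C * hh n /\ `|v t - V n (node n t)| <= C * hh n.

Let F t := v t + g (x t).

Lemma limit_bounded t : 0 <= t <= T -> `|x t| <= M /\ `|v t| <= M.
Proof.
move=> /[dup] tT /andP[t0 tle].
have b n : `|x t| <= M + C * hh n /\ `|v t| <= M + C * hh n.
  have [h1 h2] := xv_limit n tT; have [h3 _] := node_itv n t0.
  have [h4 h5] := XV_bounded (le_trans h3 tle).
  have := ler_normD (x t - X n (node n t)) (X n (node n t)).
  have := ler_normD (v t - V n (node n t)) (V n (node n t)).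
  by rewrite !subrK; split; lra.
by split; apply: (le_hh_limit ltr01) => n _; [exact: (b n).1|exact: (b n).2].
Qed.

Lemma limit_subdifferential t : 0 <= t <= T -> subdifferential dot phi (x t) (v t).
Proof.
move=> tT; apply: (@subdifferential_closed _ _ _ dot_norm _ phi_proper
  (fun n => X n (node n t)) (fun n => V n (node n t))) => //; last first.
- by move=> n; have [] := XV_scheme n (node n t).
- by apply: (@hh_close_cvg _ _ C) => n; have [] := xv_limit n tT.
by apply: (@hh_close_cvg _ _ C) => n; have [] := xv_limit n tT.
Qed.

Lemma limit_init : x 0 = x0 /\ v 0 = v0.
Proof.
have t00 : 0 <= (0 : R) <= T by rewrite lexx T_ge0.
have n0 n : node n 0 = 0%N by have := node_nat n 0; rewrite mul0r.
have h n := xv_limit n t00.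
split; apply/eqP; rewrite -subr_eq0 -normr_le0;
  apply: (@le_hh_limit _ _ C _ ltr01) => n _; have [h1 h2] := h n; rewrite add0r.
  by move: h1; rewrite n0 X_init.
by move: h2; rewrite n0 V_init.
Qed.

Lemma limit_lipschitz s t : 0 <= s -> s <= t -> t <= T ->
  `|x t - x s| <= B / c0 * (t - s) /\ `|v t - v s| <= B * (t - s).
Proof.
move=> s0 st tT; have t0 := le_trans s0 st; have [B0 C0] := (B_ge0, C_ge0).
have sT := le_trans st tT.
have tT' : 0 <= t <= T by rewrite t0.
have sT' : 0 <= s <= T by rewrite s0.
have Bc0 : 0 <= B / c0 by rewrite divr_ge0// ltW.
have b n : `|x t - x s| <= B / c0 * (t - s) + (2 * C + B / c0) * hh n /\
           `|v t - v s| <= B * (t - s) + (2 * C + B) * hh n.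
  have [h1 h2] := xv_limit n tT'; have [h3 h4] := xv_limit n sT'.
  have [n1 n2] := node_itv n t0; have [n3 n4] := node_itv n s0.
  have [i1 i2] := XV_increment (node_le n st) (le_trans n1 tT).
  have d1 : (node n t)%:R * hh n - (node n s)%:R * hh n <= t - s + hh n by lra.
  have d2 : ((node n t)%:R * hh n - (node n s)%:R * hh n) * B <= (t - s + hh n) * B.
    by rewrite ler_wpM2r.
  have i1' : `|X n (node n t) - X n (node n s)| <= (t - s + hh n) * (B / c0).
    by rewrite mulrA ler_pdivlMr// mulrC; lra.
  have q1 := ler_normD (x t - X n (node n t)) (X n (node n t) - X n (node n s)).
  have q2 := ler_normD (x t - X n (node n s)) (X n (node n s) - x s).
  have q3 := ler_normD (v t - V n (node n t)) (V n (node n t) - V n (node n s)).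
  have q4 := ler_normD (v t - V n (node n s)) (V n (node n s) - v s).
  rewrite !addrA !subrK in q1 q2 q3 q4.
  rewrite [`|X n (node n s) - x s|]distrC in q2.
  rewrite [`|V n (node n s) - v s|]distrC in q4.
  by split; lra.
by split; apply: (le_hh_limit ltr01) => n _; [exact: (b n).1|exact: (b n).2].
Qed.

Lemma limit_lower_order_lipschitz s t : 0 <= s -> s <= t -> t <= T ->
  `|F t - F s| <= B * (1 + L / c0) * (t - s).
Proof.
move=> s0 st tT; have [h1 h2] := limit_lipschitz s0 st tT.
have tT' : 0 <= t <= T by rewrite (le_trans s0 st).
have sT' : 0 <= s <= T by rewrite s0 (le_trans st tT).
have [[xt _] [xs _]] := (limit_bounded tT', limit_bounded sT').
have := gL xt xs; have : L * `|x t - x s| <= L * (B / c0 * (t - s)) by rewrite ler_wpM2l.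
have -> : F t - F s = (v t - v s) + (g (x t) - g (x s)).
  by apply: (dot_ext dot_norm) => z; rewrite !dotE; ring.
have := ler_normD (v t - v s) (g (x t) - g (x s)).
lra.
Qed.

(** The equation integrated over [[s, t]], with the coefficient and the lower
    order term frozen at [tau]. Since [lam] may jump, freezing costs its
    variation over a slightly larger interval, which starts at [s'] because the
    grid point before [s] may lie strictly to the left of [s]. *)
Lemma limit_interval_estimate s' s t tau : 0 <= s' -> s' < s -> s <= t ->
  t <= T -> s' <= tau <= t ->
  `|lam tau *: (x t - x s) + (v t - v s) + (t - s) *: F tau| <=
  (t - s) * (B / c0 * (nu t - nu s') + B * (1 + L / c0) * (t - s')).
Proof.
move=> s'0 s's st tT /andP[s'tau taut].
have [B0 C0] := (B_ge0, C_ge0); have L0 := L_ge0.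
have s0 : 0 <= s by lra.
have t0 : 0 <= t by lra.
have tau0 : 0 <= tau by lra.
have tauT := le_trans taut tT.
have Bc0 : 0 <= B / c0 by rewrite divr_ge0// ltW.
have Lc0 : 0 <= L / c0 by rewrite divr_ge0// ltW.
set K := B * (1 + L / c0).
have K0 : 0 <= K by rewrite mulr_ge0//; lra.
have tT' : 0 <= t <= T by rewrite t0.
have sT' : 0 <= s <= T by rewrite s0 (le_trans st).
pose eta := B / c0 * (nu t - nu s') + K * (t - s').
have nus't : nu s' <= nu t by apply: nu_mono; lra.
have eta0 : 0 <= eta.
  by rewrite addr_ge0// mulr_ge0//; lra.
pose l := lam tau; have l0 : 0 <= l := lam_ge0 tau.
pose c := eta + (t - s + 1) * ((1 + L) * C) + 2 * C * (l + 1) + `|F tau|.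
have d0 : 0 < Num.min 1 (s - s') by rewrite lt_min ltr01 subr_gt0.
apply: (@le_hh_limit _ _ c _ d0) => n; rewrite lt_min => /andP[h1 hs].
have h0 := hh_gt0 n.
have [x1 v1] := xv_limit n tT'; have [x2 v2] := xv_limit n sT'.
have [n1 n2] := node_itv n t0; have [n3 n4] := node_itv n s0.
pose a k := l *: X n k + V n k + (k%:R * hh n) *: F tau.
pose etah := eta + (1 + L) * C * hh n.
have etah0 : 0 <= etah by rewrite addr_ge0// !mulr_ge0//; lra.
have stepa k : (node n s <= k)%N -> (k < node n t)%N ->
    `|a k.+1 - a k| <= hh n * etah.
  move=> ik kj.
  have tk1 : s' <= k%:R * hh n.
    have : (node n s)%:R * hh n <= k%:R * hh n by rewrite ler_wpM2r ?ler_nat// ltW.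
    by lra.
  have tk2 : k%:R * hh n <= t.
    by apply: le_trans n1; rewrite ler_wpM2r ?(ltW h0)// ler_nat ltnW.
  have tk0 : 0 <= k%:R * hh n by lra.
  have tkT' : 0 <= k%:R * hh n <= T by rewrite tk0; lra.
  have tkT : k%:R * hh n <= T by lra.
  have [sX sV] := XV_step tkT.
  have [xk vk] := xv_limit n tkT'; rewrite node_nat in xk vk.
  have [_ eq] := XV_scheme n k.
  have dl : `|l - lam (k%:R * hh n)| <= nu t - nu s'.
    have [tk|tk] := leP tau (k%:R * hh n).
      have := lam_nu tk; rewrite distrC -/l; have := nu_mono s'tau.
      have := nu_mono tk2; lra.
    have := lam_nu (ltW tk); rewrite -/l; have := nu_mono tk1.
    have := nu_mono taut; lra.
  have dF : `|F tau - F (k%:R * hh n)| <= K * (t - s').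
    have [tk|tk] := leP tau (k%:R * hh n).
      have := limit_lower_order_lipschitz tau0 tk tkT; rewrite distrC -/K.
      have : K * (k%:R * hh n - tau) <= K * (t - s') by rewrite ler_wpM2l//; lra.
      lra.
    have := limit_lower_order_lipschitz tk0 (ltW tk) tauT; rewrite -/K.
    have : K * (tau - k%:R * hh n) <= K * (t - s') by rewrite ler_wpM2l//; lra.
    lra.
  have dFk : `|F (k%:R * hh n) - (V n k + g (X n k))| <= (1 + L) * C * hh n.
    have [xM _] := limit_bounded tkT'; have [XM _] := XV_bounded tkT.
    have -> : F (k%:R * hh n) - (V n k + g (X n k)) = (v (k%:R * hh n) - V n k)
       + (g (x (k%:R * hh n)) - g (X n k)).
      by apply: (dot_ext dot_norm) => z; rewrite !dotE; ring.
    have := ler_normD (v (k%:R * hh n) - V n k) (g (x (k%:R * hh n)) - g (X n k)).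
    have := gL xM XM.
    have : L * `|x (k%:R * hh n) - X n k| <= L * (C * hh n) by rewrite ler_wpM2l.
    lra.
  have -> : a k.+1 - a k = (l - lam (k%:R * hh n)) *: (X n k.+1 - X n k)
     + hh n *: ((F tau - F (k%:R * hh n))
     + (F (k%:R * hh n) - (V n k + g (X n k)))).
    rewrite -[LHS]subr0 -eq /a -natr1.
    by apply: (dot_ext dot_norm) => z; rewrite !dotE; ring.
  apply: le_trans (ler_normD _ _) _; rewrite !normrZ (gtr0_norm h0).
  have m1 : `|l - lam (k%:R * hh n)| * `|X n k.+1 - X n k| <=
      (nu t - nu s') * (hh n * (B / c0)).
    by apply: ler_pM => //; rewrite mulrA ler_pdivlMr// mulrC.
  have := ler_normD (F tau - F (k%:R * hh n))
    (F (k%:R * hh n) - (V n k + g (X n k))).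
  rewrite -(ler_pM2l h0) => m2.
  have m3 : hh n * `|F tau - F (k%:R * hh n)| <= hh n * (K * (t - s')).
    by rewrite ler_pM2l.
  have m4 : hh n * `|F (k%:R * hh n) - (V n k + g (X n k))| <=
     hh n * ((1 + L) * C * hh n) by rewrite ler_pM2l.
  rewrite /etah /eta; lra.
have tele j : (node n s <= j)%N -> (j <= node n t)%N ->
    `|a j - a (node n s)| <= (j%:R * hh n - (node n s)%:R * hh n) * etah.
  elim: j => [|j IH]; first by rewrite leqn0 => /eqP -> _; rewrite !subrr normr0 mul0r.
  rewrite leq_eqVlt => /predU1P[-> _|ij jt]; first by rewrite !subrr normr0 mul0r.
  have {}IH := IH ij (ltnW jt); have st1 := stepa _ ij jt.
  have := ler_normD (a j.+1 - a j) (a j - a (node n s)); rewrite addrA subrK.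
  by rewrite -natr1; lra.
have at_ := tele _ (node_le n st) (leqnn _).
set i := node n s in at_ x2 v2 n3 n4 *; set j := node n t in at_ x1 v1 n1 n2 *.
have -> : l *: (x t - x s) + (v t - v s) + (t - s) *: F tau = (a j - a i)
  + (l *: (x t - X n j) - l *: (x s - X n i) + (v t - V n j) - (v s - V n i)
  + ((t - j%:R * hh n) - (s - i%:R * hh n)) *: F tau).
  by rewrite /a; apply: (dot_ext dot_norm) => z; rewrite !dotE; ring.
apply: le_trans (ler_normD _ _) _.
have b1 : (j%:R * hh n - i%:R * hh n) * etah <= (t - s + hh n) * etah.
  by rewrite ler_wpM2r//; lra.
have q1 := ler_normD (l *: (x t - X n j) - l *: (x s - X n i) + (v t - V n j) - (v s - V n i))
  (((t - j%:R * hh n) - (s - i%:R * hh n)) *: F tau).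
have q2 := ler_normB (l *: (x t - X n j) - l *: (x s - X n i) + (v t - V n j)) (v s - V n i).
have q3 := ler_normD (l *: (x t - X n j) - l *: (x s - X n i)) (v t - V n j).
have q4 := ler_normB (l *: (x t - X n j)) (l *: (x s - X n i)).
rewrite !normrZ (ger0_norm l0) in q4; rewrite normrZ in q1.
have r1 : l * `|x t - X n j| <= l * (C * hh n) by rewrite ler_wpM2l.
have r2 : l * `|x s - X n i| <= l * (C * hh n) by rewrite ler_wpM2l.
have r3 : `|(t - j%:R * hh n) - (s - i%:R * hh n)| * `|F tau| <= hh n * `|F tau|.
  by rewrite ler_wpM2r// ler_norml; lra.
have r4 : hh n * hh n * ((1 + L) * C) <= hh n * ((1 + L) * C).
  have LC0 : 0 <= (1 + L) * C by rewrite mulr_ge0//; lra.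
  have hh1 : hh n * hh n <= hh n * 1 by rewrite ler_pM2l//; exact: ltW.
  by rewrite ler_wpM2r//; lra.
rewrite /c; rewrite /etah in b1 at_; rewrite -/eta; lra.
Qed.

End LimitProperties.
End Limit.

(** * Total variation and calculus of curves *)

Section MonotoneAndBoundedVariation.
Variable R : realType.
Local Notation mu := (@lebesgue_measure R).

(** A monotone function has countably many discontinuities. *)
Lemma nondecreasing_ae_continuous (nu : R -> R) (a b : R) :
  (forall s t, s <= t -> nu s <= nu t) ->
  {ae mu, forall t, a < t < b -> forall e, 0 < e ->
    exists2 d : R, 0 < d & nu (t + d) - nu (t - d) <= e}.
Proof.
move=> ndn; set D := [set x | x \in (`]a, b[) /\ discontinuity nu x].
have cD : countable D by apply: discontinuity_countable => s t _ _; exact: ndn.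
have mD : measurable D by exact: countable_measurable.
exists D; split; [exact: mD|exact: countable_lebesgue_measure0|].
move=> t /= /not_implyP[tab /existsNP[e /not_implyP[e0 nd]]].
have cl : cvg (nu x @[x --> t^'-]).
  apply: nondecreasing_at_left_is_cvgr; first by near=> x => ? ? _ _; exact: ndn.
  near=> x; exists (nu t) => _ /= [y /[!in_itv]/= /andP[_ yt] <-]; exact/ndn/ltW.
have cr : cvg (nu x @[x --> t^'+]).
  apply: nondecreasing_at_right_is_cvgr; first by near=> x => ? ? _ _; exact: ndn.
  near=> x; exists (nu t) => _ /= [y /[!in_itv]/= /andP[ty _] <-]; exact/ndn/ltW.
split; first by rewrite in_itv.
split => //; apply/eqP => lr; apply: nd.
have e2 : 0 < e / 2 by rewrite divr_gt0.
have /cvgrPdist_lt/(_ _ e2)[dl /= dl0 hl] := cl.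
have /cvgrPdist_lt/(_ _ e2)[dr /= dr0 hr] := cr.
pose d := Num.min dl dr / 2.
have d0 : 0 < d by rewrite divr_gt0// lt_min dl0.
have ddl : d < dl.
  have : Num.min dl dr <= dl by rewrite ge_min lexx.
  by move: dl0; rewrite /d; lra.
have ddr : d < dr.
  have : Num.min dl dr <= dr by rewrite ge_min lexx orbT.
  by move: dr0; rewrite /d; lra.
exists d => //.
have /= := hl (t - d); rewrite opprB addrC subrK (gtr0_norm d0).
move=> /(_ ddl); rewrite ltrBlDr ltrDl => /(_ d0).
have /= := hr (t + d); rewrite opprD addNKr normrN (gtr0_norm d0).
move=> /(_ ddr); rewrite ltrDl => /(_ d0).
by rewrite lr !ltr_norml; lra.
Unshelve. all: by end_near. Qed.

Definition clamp (T t : R) := Num.max 0 (Num.min t T).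

Lemma clamp_itv T t : 0 <= T -> 0 <= clamp T t <= T.
Proof. by move=> T0; rewrite /clamp le_max lexx/= ge_max T0 ge_min lexx orbT. Qed.

Lemma clamp_id T t : 0 <= t <= T -> clamp T t = t.
Proof. by move=> /andP[t0 tT]; rewrite /clamp min_l// max_r. Qed.

Lemma clamp_le T s t : s <= t -> clamp T s <= clamp T t.
Proof.
move=> st; rewrite /clamp ge_max le_max lexx/= le_max le_min !ge_min st lexx.
by rewrite !orbT.
Qed.

Lemma clamp_lipschitz T s t : s <= t -> clamp T t - clamp T s <= t - s.
Proof.
move=> st; rewrite /clamp.
have [h1|h1] := leP t T; have [h2|h2] := leP s T.
- by have [h3|h3] := leP 0 t; have [h4|h4] := leP 0 s; lra.
- lra.
- by have [h3|h3] := leP 0 T; have [h4|h4] := leP 0 s; lra.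
by have [h3|h3] := leP 0 T; lra.
Qed.

(** The variation function of [f] on [[0, t]] dominates both the jumps and the
    oscillation of [f]. Clamping the time makes the estimate hold on the whole
    line, so that later estimates carry no membership conditions. *)
Lemma bounded_variation_clamp T (f : R -> R) : 0 <= T ->
  bounded_variation 0 T f ->
  exists nu : R -> R, (forall s t, s <= t -> nu s <= nu t) /\
    forall s t, s <= t -> `|f (clamp T t) - f (clamp T s)| <= nu t - nu s.
Proof.
move=> T0 /(bounded_variationP _ T0) fT.
have fint t : 0 <= t <= T -> total_variation 0 t f \is a fin_num.
  move=> /andP[t0 tT]; move: fT; rewrite (total_variationD f t0 tT).
  by rewrite fin_numD => /andP[].
have key s t : s <= t ->
    (`|f (clamp T t) - f (clamp T s)|%:E <=
    (fine (total_variation 0 (clamp T t) f) - fine (total_variation 0 (clamp T s) f))%:E)%E.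
  move=> st; have /andP[s0 sT] := clamp_itv s T0.
  have /andP[t0 tT] := clamp_itv t T0.
  have cst := clamp_le T st.
  apply: le_trans (total_variation_ge f cst) _.
  rewrite EFinB !fineK ?fint ?s0 ?t0//.
  rewrite [X in (_ <= X - _)%E](total_variationD f s0 cst).
  by rewrite [X in (_ <= X - _)%E]addeC addeK// fint// s0.
exists (fun t => fine (total_variation 0 (clamp T t) f)); split => s t st.
  rewrite -subr_ge0; have := key _ _ st; rewrite lee_fin.
  by move=> h; exact: le_trans h.
by have := key _ _ st; rewrite lee_fin.
Qed.

End MonotoneAndBoundedVariation.

Section CurveCalculus.
Variables (R : realType) (H : completeNormedModType R).
Variable dot : {dot H for idfun}.
Hypothesis dot_norm : forall x : H, dot x x = `|x| ^+ 2.

Lemma derivable_comb (y w : R -> H) (l : R) (e : H) t :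
  derivable y t 1 -> derivable w t 1 ->
  derivable (fun u => l *: y u + w u + u *: e) t 1 /\
  derive1 (fun u => l *: y u + w u + u *: e) t = l *: derive1 y t + derive1 w t + e.
Proof.
move=> dy dw; apply: firstorder_derivable => eps eps0.
have l1 : 0 < `|l| + 1 by rewrite ltr_wpDl.
have e1 : 0 < eps / (2 * (`|l| + 1)) by rewrite divr_gt0// mulr_gt0.
have e2 : 0 < eps / 2 by rewrite divr_gt0.
have [d1 d10 h1] := derivable_firstorder dy e1.
have [d2 d20 h2] := derivable_firstorder dw e2.
exists (Num.min d1 d2); first by rewrite lt_min d10.
move=> h; rewrite lt_min => /andP[/h1{}h1 /h2{}h2].
have -> : l *: y (t + h) + w (t + h) + (t + h) *: e - (l *: y t + w t + t *: e)
    - h *: (l *: derive1 y t + derive1 w t + e) =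
    l *: (y (t + h) - y t - h *: derive1 y t) +
    (w (t + h) - w t - h *: derive1 w t).
  by apply: (dot_ext dot_norm) => z; rewrite !dotE; ring.
apply: le_trans (ler_normD _ _) _; rewrite normrZ.
have : `|l| * `|y (t + h) - y t - h *: derive1 y t| <=
    (`|l| + 1) * (eps / (2 * (`|l| + 1)) * `|h|).
  by apply: ler_pM => //; rewrite lerDl.
have -> : (`|l| + 1) * (eps / (2 * (`|l| + 1)) * `|h|) = eps / 2 * `|h|.
  by field; rewrite gt_eqF.
lra.
Qed.

(** At a continuity point of [nu] the estimate makes [l x + v] differentiable;
    differentiability of [v] then follows from that of [x]. *)
Lemma interval_estimate_derivative (x v : R -> H) (l T A K : R) (F : H)
    (nu : R -> R) t :
  0 <= A -> 0 <= K -> 0 < t < T -> (forall r s, r <= s -> nu r <= nu s) ->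
  (forall e, 0 < e -> exists2 d : R, 0 < d & nu (t + d) - nu (t - d) <= e) ->
  (forall s' s u, 0 <= s' -> s' < s -> s <= u -> u <= T -> s' <= t <= u ->
    `|l *: (x u - x s) + (v u - v s) + (u - s) *: F| <=
    (u - s) * (A * (nu u - nu s') + K * (u - s'))) ->
  derivable x t 1 ->
  derivable v t 1 /\ l *: derive1 x t + derive1 v t + F = 0.
Proof.
move=> A0 K0 /andP[t0 tT] ndn cn est dx.
pose z u := l *: x u + v u.
have [dz zE] : derivable z t 1 /\ derive1 z t = - F.
  apply: firstorder_derivable => e e0.
  have A1 : 0 < A + 1 by lra.
  have K1 : 0 < K + 1 by lra.
  have [d d0 hd] := cn (e / (2 * (A + 1))) (divr_gt0 e0 (mulr_gt0 (ltr0Sn _ 1) A1)).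
  pose rho := Num.min (d / 2) (Num.min (t / 2) (Num.min (T - t) (e / (4 * (K + 1))))).
  exists rho.
    by rewrite !lt_min !divr_gt0//= ?mulr_gt0// subr_gt0 tT.
  move=> h; rewrite !lt_min => /and4P[hd' ht hT hK].
  rewrite ltr_pdivlMr ?mulr_gt0// in hK.
  have bnd s' u : t - d <= s' -> s' <= u -> u <= t + d -> u - s' <= 2 * `|h| ->
      A * (nu u - nu s') + K * (u - s') <= e.
    move=> ds' s'u ud us.
    have n1 : nu u - nu s' <= e / (2 * (A + 1)).
      apply: le_trans hd; have := ndn _ _ ds'; have := ndn _ _ ud; lra.
    have n0 : 0 <= nu u - nu s' by rewrite subr_ge0 ndn.
    have m1 : A * (nu u - nu s') <= (A + 1) * (e / (2 * (A + 1))).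
      by apply: ler_pM => //; lra.
    have E1 : (A + 1) * (e / (2 * (A + 1))) = e / 2 by field; rewrite gt_eqF.
    have m2 : K * (u - s') <= K * (2 * `|h|) by rewrite ler_wpM2l.
    have h0 := normr_ge0 h; lra.
  have zE s u : l *: (x u - x s) + (v u - v s) + (u - s) *: F =
      z u - z s - (u - s) *: (- F).
    by rewrite /z; apply: (dot_ext dot_norm) => w; rewrite !dotE; ring.
  have [hp|hn|->] := ltgtP h 0; last first.
  - by rewrite addr0 scale0r subr0 subrr !normr0 mulr0.
  - rewrite (gtr0_norm hn) in hd' ht hT bnd *.
    have := est (t - h) t (t + h); rewrite zE.
    have -> : t + h - t = h by ring.
    move=> e1; rewrite mulrC; apply: le_trans (e1 _ _ _ _ _) _; try lra.
    by rewrite ler_pM2l//; apply: bnd; lra.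
  rewrite (ltr0_norm hp) in hd' ht hT bnd *.
  have := est (t + h + h) (t + h) t; rewrite zE.
  have -> : t - (t + h) = - h by ring.
  have -> : z (t + h) - z t - h *: (- F) = - (z t - z (t + h) - (- h) *: (- F)).
    by apply: (dot_ext dot_norm) => w; rewrite !dotE; ring.
  move=> e1; rewrite normrN mulrC; apply: le_trans (e1 _ _ _ _ _) _; try lra.
  by rewrite ler_pM2l ?oppr_gt0//; apply: bnd; lra.
have [dv vE] := derivable_comb (- l) 0 dx dz.
have vz : (fun u => - l *: x u + z u + u *: 0) = v.
  apply/funext => u; rewrite /z.
  by apply: (dot_ext dot_norm) => w; rewrite !(dotE, dot0l); ring.
rewrite vz in dv vE; split => //; rewrite vE zE.
by apply: (dot_ext dot_norm) => w; rewrite !(dotE, dot0l); ring.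
Qed.

(** The quotient [<dy, dw> / h^2] is nonnegative. *)
Lemma derivative_monotone (y w : R -> H) t (rho : R) : 0 < rho ->
  (forall h, `|h| < rho -> 0 <= dot (y (t + h) - y t) (w (t + h) - w t)) ->
  derivable y t 1 -> derivable w t 1 -> 0 <= dot (derive1 y t) (derive1 w t).
Proof.
move=> rho0 mono dy dw; rewrite !derive1E.
have c := cvg_dot dot_norm _ dy dw.
rewrite -(cvg_lim (@Rhausdorff R) (c _)).
apply: limr_ge; first by apply/cvg_ex; eexists; exact: c.
apply/nbhs_normP; exists rho => // h /=; rewrite sub0r normrN => hr _.
rewrite dotZl dotZr mulrA -expr2 mulr_ge0 ?sqr_ge0// scaler1 [h + t]addrC.
exact: mono.
Qed.

(** The curve moves by at most [1] on intervals shorter than some [d]. *)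
Lemma absolutely_continuous_bounded (f : R -> H) (T : R) : 0 <= T ->
  absolutely_continuous 0 T f ->
  exists2 M : R, 0 <= M & forall t, 0 <= t <= T -> `|f t| <= M.
Proof.
move=> T0 acf; have [d d0 hd] := acf 1 ltr01.
have short s t : 0 <= s -> s <= t -> t <= T -> t - s < d -> `|f t - f s| <= 1.
  move=> s0 st tT tsd.
  have := hd 1%N (fun=> s) (fun=> t); rewrite !big_ord1 => h.
  apply/ltW/h => //.
  by apply/trivIsetP => i j _ _; rewrite !ord1 eqxx.
have d2 : 0 < d / 2 by rewrite divr_gt0.
have bn n t : 0 <= t <= T -> t <= n%:R * (d / 2) -> `|f t| <= `|f 0| + n%:R.
  elim: n t => [|n IH] t /andP[t0 tT].
    rewrite mul0r addr0 => t0'; suff -> : t = 0 by [].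
    by apply/eqP; rewrite eq_le t0'.
  rewrite -natr1 => tn.
  have [tn'|tn'] := leP t (n%:R * (d / 2)).
    by have := IH t _ tn'; rewrite t0 => /(_ tT); lra.
  have nd0 : 0 <= n%:R * (d / 2) by rewrite mulr_ge0// ltW.
  have := IH (n%:R * (d / 2)); rewrite nd0 lexx (le_trans (ltW tn') tT).
  move=> /(_ isT isT) IHn.
  have := short (n%:R * (d / 2)) t nd0 (ltW tn') tT.
  have := ler_normD (f t - f (n%:R * (d / 2))) (f (n%:R * (d / 2))).
  by rewrite subrK; lra.
exists (`|f 0| + (Num.truncn (T / (d / 2))).+1%:R) => // t /[dup] tT /andP[t0 tle].
apply: bn => //; apply: le_trans tle _.
by rewrite -ler_pdivrMr// ltW// truncnS_gt.
Qed.

End CurveCalculus.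

(** * Strong solutions *)

Section AlmostEverywhere.
Variable R : realType.
Local Notation mu := (@lebesgue_measure R).

Lemma ae_imply (P Q : R -> Prop) : (forall t, P t -> Q t) ->
  {ae mu, forall t, P t} -> {ae mu, forall t, Q t}.
Proof. by move=> PQ; apply: negligibleS => t /= nQ p; exact/nQ/PQ. Qed.

Lemma ae_and (P Q : R -> Prop) :
  {ae mu, forall t, P t} -> {ae mu, forall t, Q t} ->
  {ae mu, forall t, P t /\ Q t}.
Proof.
move=> aP aQ; apply: negligibleS (negligibleU aP aQ) => t /= nPQ.
by have [p|np] := pselect (P t); [right=> q; exact: nPQ|left].
Qed.

End AlmostEverywhere.

Section Solution.
Variables (R : realType) (H : completeNormedModType R).
Variable dot : {dot H for idfun}.
Hypothesis dot_norm : forall x : H, dot x x = `|x| ^+ 2.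
Variable phi : H -> \bar R.
Hypothesis phi_proper : proper_function phi.
Variable g : H -> H.
Variables (lam nu : R -> R) (c0 : R).
Hypothesis c0_gt0 : 0 < c0.
Hypothesis lam_ge : forall t, c0 <= lam t.
Hypothesis nu_mono : forall s t, s <= t -> nu s <= nu t.
Hypothesis lam_nu : forall s t, s <= t -> `|lam t - lam s| <= nu t - nu s.
Variables (T : R) (y w : R -> H).
Hypothesis y_ac : absolutely_continuous 0 T y.
Hypothesis w_ac : absolutely_continuous 0 T w.
Hypothesis yw_graph : forall t, 0 <= t <= T -> subdifferential dot phi (y t) (w t).
Local Notation mu := (@lebesgue_measure R).
Local Notation F t := (w t + g (y t)).
Hypothesis yw_eq : {ae mu, forall t, 0 < t < T ->
  [/\ derivable y t 1, derivable w t 1 &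
      lam t *: derive1 y t + derive1 w t + F t = 0]}.

(** Pair the equation with monotonicity of the derivatives, exactly as for the
    increments of the scheme. *)
Lemma solution_derivative_bound t : 0 < t < T ->
  derivable y t 1 -> derivable w t 1 ->
  lam t *: derive1 y t + derive1 w t + F t = 0 ->
  c0 * `|derive1 y t| <= `|F t| /\ `|derive1 w t| <= `|F t|.
Proof.
move=> /andP[t0 tT] dy dw eq; have lamt := lam_ge t; have c0' := c0_gt0.
have mono : 0 <= dot (derive1 y t) (derive1 w t).
  apply: (derivative_monotone dot_norm (rho := Num.min t (T - t))) => //.
    by rewrite lt_min t0 subr_gt0.
  move=> h; rewrite lt_min => /andP[]; rewrite !ltr_norml => h1 h2.
  by apply: (subdifferential_monotone phi_proper); apply: yw_graph; lra.
have l0 : 0 <= lam t by lra.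
have [h1 h2] := monotone_norm_le dot_norm l0 mono.
have E : `|lam t *: derive1 y t + derive1 w t| = `|F t|.
  by move/eqP: eq; rewrite addr_eq0 => /eqP ->; rewrite normrN.
rewrite -E; split => //; apply: le_trans h1; exact: ler_wpM2r.
Qed.

Variable B : R.
Hypothesis F_bound : forall t, 0 <= t <= T -> `|F t| <= B.

Lemma solution_lipschitz s t : 0 <= s -> s <= t -> t <= T ->
  `|y t - y s| <= B / c0 * (t - s) /\ `|w t - w s| <= B * (t - s).
Proof.
move=> s0 st tT.
have B0 : 0 <= B by apply: le_trans (F_bound (_ : 0 <= t <= T)) => //; lra.
have Bc0 : 0 <= B / c0 by rewrite divr_ge0// ltW.
have bound : {ae mu, forall u, s < u < t ->
    [/\ derivable y u 1, derivable w u 1,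
        `|derive1 y u| <= B / c0 & `|derive1 w u| <= B]}.
  apply: ae_imply yw_eq => u eq /andP[su ut].
  have uT : 0 < u < T by lra.
  have [dy dw e] := eq uT.
  have [h1 h2] := solution_derivative_bound uT dy dw e.
  have FB := @F_bound u; split => //.
    by rewrite ler_pdivlMr// mulrC; apply: le_trans h1 _; apply: FB; lra.
  by apply: le_trans h2 _; apply: FB; lra.
split; apply: absolutely_continuous_le => //.
- exact: absolutely_continuousS y_ac.
- by apply: ae_imply bound => u h /h[].
- exact: absolutely_continuousS w_ac.
- by apply: ae_imply bound => u h /h[].
Qed.

Variables M L : R.
Hypothesis L_ge0 : 0 <= L.
Hypothesis gL : forall u u', `|u| <= M -> `|u'| <= M ->
  `|g u - g u'| <= L * `|u - u'|.
Hypothesis y_bound : forall t, 0 <= t <= T -> `|y t| <= M.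

(** The curve [u |-> lam s *: y u + w u + u *: F s] has, almost everywhere, a
    derivative controlled by the variation of [lam] and by the Lipschitz
    constants; [absolutely_continuous_le] integrates this bound. *)
Lemma solution_residual s t : 0 <= s -> s <= t -> t <= T ->
  `|lam s *: (y t - y s) + (w t - w s) + (t - s) *: F s| <=
  (t - s) * (B / c0 * (nu t - nu s) + B * (1 + L / c0) * (t - s)).
Proof.
move=> s0 st tT; have L0 := L_ge0; have c0' := c0_gt0.
have B0 : 0 <= B by apply: le_trans (F_bound (_ : 0 <= t <= T)) => //; lra.
have Bc0 : 0 <= B / c0 by rewrite divr_ge0// ltW.
have Lc0 : 0 <= L / c0 by rewrite divr_ge0// ltW.
set K := B * (1 + L / c0).
have K0 : 0 <= K by rewrite mulr_ge0//; lra.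
have nust := nu_mono st.
pose z u := lam s *: y u + w u + u *: F s.
have -> : lam s *: (y t - y s) + (w t - w s) + (t - s) *: F s = z t - z s.
  by rewrite /z; apply: (dot_ext dot_norm) => a; rewrite !dotE; ring.
rewrite mulrC; apply: absolutely_continuous_le => //.
- by rewrite addr_ge0// mulr_ge0//; lra.
- apply: (@lipschitz_absolutely_continuous _ _ _ _
    (`|lam s| * (B / c0) + B + `|F s|)) => p q sp pq qt.
  have [||h1 h2] := @solution_lipschitz p q _ pq _; [lra|lra|].
  have -> : z q - z p = lam s *: (y q - y p) + (w q - w p) + (q - p) *: F s.
    by rewrite /z; apply: (dot_ext dot_norm) => a; rewrite !dotE; ring.
  apply: le_trans (ler_normD _ _) _.
  have := ler_normD (lam s *: (y q - y p)) (w q - w p).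
  rewrite !normrZ (ger0_norm (_ : 0 <= q - p)) ?subr_ge0//.
  have : `|lam s| * `|y q - y p| <= `|lam s| * (B / c0 * (q - p)).
    by rewrite ler_wpM2l.
  lra.
apply: ae_imply yw_eq => u eq /andP[su ut].
have uT : 0 < u < T by lra.
have [dy dw e] := eq uT.
have [dz ->] := derivable_comb dot_norm (lam s) (F s) dy dw.
split => //.
have [h1 _] := solution_derivative_bound uT dy dw e.
have [|l1 l2] := @solution_lipschitz s u s0 (ltW su) _; first by lra.
have uT' : 0 <= u <= T by lra.
have sT' : 0 <= s <= T by lra.
have Fu := F_bound uT'.
have -> : lam s *: derive1 y u + derive1 w u + F s =
    (lam s - lam u) *: derive1 y u - ((w u - w s) + (g (y u) - g (y s))).
  rewrite -[LHS]subr0 -e.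
  by apply: (dot_ext dot_norm) => a; rewrite !dotE; ring.
apply: le_trans (ler_normB _ _) _; rewrite normrZ distrC.
have m1 : `|lam u - lam s| * `|derive1 y u| <= (nu t - nu s) * (B / c0).
  apply: ler_pM => //.
    have := lam_nu (ltW su); have := nu_mono (ltW ut); lra.
  by rewrite ler_pdivlMr// mulrC; lra.
have := ler_normD (w u - w s) (g (y u) - g (y s)).
have := gL (y_bound uT') (y_bound sT').
have : L * `|y u - y s| <= L * (B / c0 * (u - s)) by rewrite ler_wpM2l.
have : K * (u - s) <= K * (t - s) by rewrite ler_wpM2l//; lra.
rewrite {1}/K; lra.
Qed.

Hypothesis T_ge0 : 0 <= T.

Lemma solution_close_to_scheme :
  (forall C, exists2 L : R, 0 <= L & forall x y,
     `|x| <= C -> `|y| <= C -> `|g x - g y| <= L * `|x - y|) ->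
  exists2 C : R, 0 <= C & forall h X V, 0 < h ->
    scheme dot phi g lam h X V -> y 0 = X 0%N -> w 0 = V 0%N ->
    (forall k, k%:R * h <= T -> `|X k| <= M) ->
    forall k, k%:R * h <= T ->
      `|X k - y (k%:R * h)| <= C * h /\ `|V k - w (k%:R * h)| <= C * h.
Proof.
move=> g_lip; have L0 := L_ge0; have c0' := c0_gt0.
have B0 : 0 <= B by apply: le_trans (F_bound (_ : 0 <= 0 <= T)) => //; rewrite lexx.
have Bc0 : 0 <= B / c0 by rewrite divr_ge0// ltW.
have Lc0 : 0 <= L / c0 by rewrite divr_ge0// ltW.
have K0 : 0 <= B * (1 + L / c0) by rewrite mulr_ge0//; lra.
have [C C0 cons] := scheme_consistency dot_norm phi_proper g_lip c0_gt0 lam_ge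
  nu_mono lam_nu M T_ge0 Bc0 K0.
exists C => // h X V h0 sch y0 w0 XM k kT.
apply: (cons h X V (fun j => y (j%:R * h)) (fun j => w (j%:R * h))) => //.
- by rewrite mul0r.
- by rewrite mul0r.
- move=> j jT; have jT' : 0 <= j%:R * h <= T by rewrite jT mulr_ge0// ltW.
  by split; [exact: XM|exact: y_bound|exact: yw_graph].
move=> j jT; have jh : j.+1%:R * h - j%:R * h = h by rewrite -natr1; ring.
have := @solution_residual (j%:R * h) (j.+1%:R * h).
rewrite jh; apply => //; first by rewrite mulr_ge0// ltW.
by rewrite ler_wpM2r ?ler_nat// ltW.
Qed.

End Solution.

Lemma lower_order_bound (R : realType) (H : normedModType R) (g : H -> H)
    (M L : R) u w : 0 <= L ->
  (forall x y, `|x| <= M -> `|y| <= M -> `|g x - g y| <= L * `|x - y|) ->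
  `|u| <= M -> `|w| <= M -> `|w + g u| <= M + (`|g 0| + L * M).
Proof.
move=> L0 gL uM wM; have h0 : `|0 : H| <= M by rewrite normr0 (le_trans _ uM).
have h1 := gL _ _ uM h0; rewrite subr0 in h1.
have h2 : L * `|u| <= L * M by rewrite ler_wpM2l.
have := ler_normD (g u - g 0) (g 0); rewrite subrK.
by have := ler_normD w (g u); lra.
Qed.

Theorem theorem4p3 (R : realType) (H : completeNormedModType R)
  (dot : {dot H for idfun})
  (dot_norm : forall x : H, dot x x = `|x| ^+ 2)
  (phi : H -> \bar R)
  (phi_proper : proper_function phi)
  (phi_convex : econvex_function phi)
  (phi_lsc : lower_semicontinuous phi)
  (psi : H -> R^o)
  (psi_convex : convex_function [set: convex_lmodType H] psi)
  (psi_diff : forall x : H, differentiable psi x)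
  (grad_lip : forall B : set H, bounded_set B ->
    [lipschitz gradient dot psi x | x in B])
  (phi_psi_lb : exists m : R, forall x : H, (m%:E <= phi x + (psi x)%:E)%E)
  (T : R) (T_gt0 : 0 < T)
  (lambda : R -> R)
  (lambda_gt0 : forall t : R, 0 <= t <= T -> 0 < lambda t)
  (lambda_BV : bounded_variation 0 T lambda)
  (c0_gt0 : 0 < inf [set lambda t | t in `[0, T]])
  (x0 v0 : H)
  (x0_dom : dom_subdifferential dot phi x0)
  (v0_subdiff : subdifferential dot phi x0 v0)
  (v0_neq0 : v0 != 0) :
  exists x v : R -> H,
    strong_solution dot phi psi T lambda x0 v0 x v /\
    (forall y w : R -> H,
       strong_solution dot phi psi T lambda x0 v0 y w ->
       forall t : R, 0 <= t <= T -> y t = x t /\ w t = v t).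
Proof.
have T0 := ltW T_gt0.
pose lam t := lambda (clamp T t).
set c0 := inf _ in c0_gt0.
have lam_ge t : c0 <= lam t.
  apply: ge_inf; first by exists 0 => _ [s /= /[!in_itv]/= sT <-]; exact/ltW/lambda_gt0.
  by exists (clamp T t) => //=; rewrite in_itv/=; exact: clamp_itv.
have lamE (t : R) : 0 <= t <= T -> lam t = lambda t by move=> tT; rewrite /lam clamp_id.
have [nu [nu_mono lam_nu0]] := bounded_variation_clamp T0 lambda_BV.
have lam_nu (s t : R) : s <= t -> `|lam t - lam s| <= nu t - nu s by exact: lam_nu0.
pose g := gradient dot psi.
have g_lip M : exists2 L : R, 0 <= L & forall x y,
    `|x| <= M -> `|y| <= M -> `|g x - g y| <= L * `|x - y|.
  have bM : bounded_set [set x : H | `|x| <= M].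
    by exists M; split; [exact: num_real|move=> a Ma x /= xM; rewrite ltW// (le_lt_trans xM)].
  have /pinfty_ex_gt0[L L0 hL] := grad_lip _ bM.
  by exists L; [exact: ltW|move=> x y xM yM; exact: (hL (x, y))].
have psi_g x y : psi x + dot (g x) (y - x) <= psi y.
  exact: gradient_convex_le.
have [h0 h0_gt0 [M XVM]] := scheme_bounded dot_norm phi_proper c0_gt0 lam_ge
  psi_g g_lip phi_psi_lb T_gt0 v0_subdiff.
pose hh n := h0 / 2 ^+ n.
have hh_gt0 n : 0 < hh n by rewrite divr_gt0// exprn_gt0.
have hh_le n : 0 < hh n <= h0.
  have p1 : 1 <= (2 : R) ^+ n by rewrite exprn_ege1// ler1n.
  by rewrite hh_gt0 /hh ler_pdivrMr ?exprn_gt0// ler_peMr// ltW.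
have hhS n : hh n.+1 = hh n / 2 by rewrite /hh exprSr invfM mulrA.
have schx n := scheme_exists dot_norm phi_proper g c0_gt0 lam_ge (hh n)
  phi_convex phi_lsc v0_subdiff.
pose X n := projT1 (cid (schx n)); pose V n := projT1 (cid (projT2 (cid (schx n)))).
have XV n : [/\ scheme dot phi g lam (hh n) (X n) (V n), X n 0%N = x0 & V n 0%N = v0].
  exact: projT2 (cid (projT2 (cid (schx n)))).
have XV_scheme n : scheme dot phi g lam (hh n) (X n) (V n) by have [] := XV n.
have X_init n : X n 0%N = x0 by have [] := XV n.
have V_init n : V n 0%N = v0 by have [] := XV n.
have XV_bounded n k : k%:R * hh n <= T -> `|X n k| <= M /\ `|V n k| <= M.
  by apply: XVM.
have M0 : 0 <= M.
  have k0 : 0%:R * hh 0%N <= T by rewrite mul0r.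
  by have [h _] := XV_bounded 0%N 0%N k0; exact: le_trans h.
have [L L0 gL] := g_lip M.
pose B := M + (`|g 0| + L * M).
have B0 : 0 <= B by rewrite !addr_ge0// mulr_ge0.
have FB u w : `|u| <= M -> `|w| <= M -> `|w + g u| <= B by exact: lower_order_bound.
have [x [v [C C0 xv]]] := scheme_limit dot_norm phi_proper g_lip c0_gt0 lam_ge
  nu_mono lam_nu B0 FB T0 hh_gt0 hhS XV_scheme X_init V_init XV_bounded.
have lip := limit_lipschitz dot_norm phi_proper c0_gt0 lam_ge B0 FB hh_gt0 hhS
  XV_scheme XV_bounded C0 xv.
(* clamping gives a Lipschitz curve on the whole line, to which
   [lipschitz_curve_ae_derivable] applies *)
pose xs t := x (clamp T t); pose vs t := v (clamp T t).
have xsE t : 0 <= t <= T -> xs t = x t by move=> tT; rewrite /xs clamp_id.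
have vsE t : 0 <= t <= T -> vs t = v t by move=> tT; rewrite /vs clamp_id.
have lips s t : 0 <= s -> s <= t -> t <= T ->
    `|xs t - xs s| <= B / c0 * (t - s) /\ `|vs t - vs s| <= B * (t - s).
  move=> s0 st tT; rewrite !xsE ?vsE ?s0 ?(le_trans s0 st) ?(le_trans st tT)//.
  exact: lip.
have xs_graph t : 0 <= t <= T -> subdifferential dot phi (xs t) (vs t).
  move=> tT; rewrite xsE// vsE//.
  exact: (limit_subdifferential dot_norm phi_proper phi_lsc hh_gt0 hhS XV_scheme xv).
have [x_0 v_0] := limit_init T0 hh_gt0 hhS X_init V_init xv.
have T00 : 0 <= (0 : R) <= T by rewrite lexx.
exists xs, vs; split.
  split => //.
  - by apply: lipschitz_absolutely_continuous => s t s0 st tT; exact: (lips _ _ s0 st tT).1.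
  - by apply: lipschitz_absolutely_continuous => s t s0 st tT; exact: (lips _ _ s0 st tT).2.
  - have xs_lip s t : `|xs t - xs s| <= B / c0 * `|t - s|.
      have Bc0 : 0 <= B / c0 by rewrite divr_ge0// ltW.
      wlog st : s t / s <= t.
        move=> hw; have [/hw//|/ltW/hw] := leP s t.
        by rewrite distrC [`|s - t|]distrC.
      have /andP[s0 _] := clamp_itv s T0; have /andP[_ tT] := clamp_itv t T0.
      have [h _] := lip _ _ s0 (clamp_le T st) tT; apply: le_trans h _.
      by rewrite ler_wpM2l// ger0_norm ?subr_ge0//; exact: clamp_lipschitz.
    (* at the end points the derivative would involve values outside [0, T] *)
    have ends : {ae (@lebesgue_measure R), forall t, t <> 0 /\ t <> T}.
      apply: ae_and; [exists [set 0]|exists [set T]]; split => //;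
        try exact: lebesgue_measure_set1;
        by move=> t /= /contrapT.
    have aed := lipschitz_curve_ae_derivable dot_norm xs_lip 0 T.
    have aec := nondecreasing_ae_continuous 0 T nu_mono.
    apply: ae_imply (ae_and ends (ae_and aed aec)) => t [[t0 tT] [dx cn]].
    move=> /andP[t0' tT'].
    have tI : 0 < t < T.
      by rewrite !lt_neqAle t0' tT' !andbT eq_sym; apply/andP; split; apply/eqP.
    have tT0 : 0 <= t <= T by rewrite t0'.
    have Bc0 : 0 <= B / c0 by rewrite divr_ge0// ltW.
    have K0 : 0 <= B * (1 + L / c0) by rewrite mulr_ge0// addr_ge0// divr_ge0// ltW.
    have [|dv eq] := interval_estimate_derivative dot_norm
      (l := lam t) (F := vs t + g (xs t)) (v := vs) Bc0 K0 tI nu_mono (cn tI) _ (dx tI).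
      move=> s' s u s'0 s's su uT /andP[s't tu].
      have s0 := le_trans s'0 (ltW s's); have u0 := le_trans s0 su.
      rewrite !(xsE, vsE) ?s0 ?u0 ?(le_trans su uT)//.
      apply: (limit_interval_estimate dot_norm phi_proper c0_gt0 lam_ge nu_mono
        lam_nu L0 gL B0 FB hh_gt0 hhS XV_scheme XV_bounded C0 xv) => //.
      by rewrite s't.
    split; [exact: dx|exact: dv|].
    by rewrite -lamE// -addrA.
  by rewrite xsE// vsE.
move=> y w [y_ac w_ac yw_graph yw_eq [y0 w0]] t tT.
have [M1 M10 yM1] := absolutely_continuous_bounded T0 y_ac.
have [M2 M20 wM2] := absolutely_continuous_bounded T0 w_ac.
pose M' := M + M1 + M2.
have MM' : M <= M' by rewrite /M'; lra.
have [L' L'0 gL'] := g_lip M'.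
have yM s : 0 <= s <= T -> `|y s| <= M' by move=> /yM1; rewrite /M'; lra.
have wM s : 0 <= s <= T -> `|w s| <= M' by move=> /wM2; rewrite /M'; lra.
pose B' := M' + (`|g 0| + L' * M').
have FB' s : 0 <= s <= T -> `|w s + g (y s)| <= B'.
  by move=> sT; apply: lower_order_bound => //; [exact: yM|exact: wM].
have yw_eq' : {ae (@lebesgue_measure R), forall s, 0 < s < T ->
    [/\ derivable y s 1, derivable w s 1 &
      lam s *: derive1 y s + derive1 w s + (w s + g (y s)) = 0]}.
  apply: ae_imply yw_eq => s h /andP[s0 sT].
  have sT' : 0 <= s <= T by rewrite !ltW.
  by have [dy dw e] := h sT'; split => //; rewrite lamE// addrA.
have [C' C'0 close] := solution_close_to_scheme dot_norm phi_proper c0_gt0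
  lam_ge nu_mono lam_nu y_ac w_ac yw_graph yw_eq' FB' L'0 gL' yM T0 g_lip.
have ylip := solution_lipschitz dot_norm phi_proper c0_gt0 lam_ge y_ac w_ac
  yw_graph yw_eq' FB'.
have /andP[t0 tle] := tT.
(* compare [y t] with [x t] through the scheme at the node preceding [t] *)
have est n : `|y t - x t| <= 0 + (C + C' + B' / c0) * hh n /\
             `|w t - v t| <= 0 + (C + C' + B') * hh n.
  have [n1 n2] := node_itv hh_gt0 n t0; set k := node hh n t in n1 n2 *.
  have kT : k%:R * hh n <= T by exact: le_trans tle.
  have k0 : 0 <= k%:R * hh n by rewrite mulr_ge0// ltW.
  have [c1 c2] := close (hh n) (X n) (V n) (hh_gt0 n) (XV_scheme n)
    (etrans y0 (esym (X_init n))) (etrans w0 (esym (V_init n)))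
    (fun j jT => le_trans (XV_bounded n j jT).1 MM') k kT.
  have [l1 l2] := ylip _ _ k0 n1 tle.
  have [e1 e2] := xv n t tT; rewrite -/k in e1 e2.
  have B'0 : 0 <= B' by apply: le_trans (FB' 0 T00).
  have Bc'0 : 0 <= B' / c0 by rewrite divr_ge0// ltW.
  have m1 : B' / c0 * (t - k%:R * hh n) <= B' / c0 * hh n by rewrite ler_wpM2l//; lra.
  have m2 : B' * (t - k%:R * hh n) <= B' * hh n by rewrite ler_wpM2l//; lra.
  have q1 := ler_normD (y t - y (k%:R * hh n)) (y (k%:R * hh n) - X n k).
  have q2 := ler_normD (y t - X n k) (X n k - x t).
  have q3 := ler_normD (w t - w (k%:R * hh n)) (w (k%:R * hh n) - V n k).
  have q4 := ler_normD (w t - V n k) (V n k - v t).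
  rewrite !addrA !subrK in q1 q2 q3 q4.
  rewrite [`|y (k%:R * hh n) - X n k|]distrC in q1; rewrite [`|X n k - x t|]distrC in q2.
  rewrite [`|w (k%:R * hh n) - V n k|]distrC in q3; rewrite [`|V n k - v t|]distrC in q4.
  by split; lra.
rewrite xsE// vsE//.
by split; apply/eqP; rewrite -subr_eq0 -normr_le0;
  apply: (le_hh_limit hh_gt0 hhS ltr01) => n _; [exact: (est n).1|exact: (est n).2].
Qed.
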